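(* Let $Y$ be a hereditarily indecomposable continuum. Then there exists a co-existentially closed continuum $X$ with $w(X) = w(Y)$ and $\operatorname{rank}(\check{H}^1(X)) \geq \operatorname{rank}(\check{H}^1(Y))$.
   Context: A continuum is a connected compact Hausdorff space (not necessarily metrizable); it is hereditarily indecomposable if no subcontinuum is the union of two proper subcontinua. $w(X)$ denotes the weight (minimal cardinality of a base) of $X$. $\check{H}^1$ is first integral Čech cohomology; the rank of an abelian group is the cardinality of a maximal $\mathbb{Z}$-independent subset. $C(X)$ denotes the C*-algebra of continuous complex-valued functions on $X$. $T_{\mathrm{conn}}$ denotes a theory of continuous first-order logic in the language of unital C*-algebras whose models are exactly the C*-algebras isomorphic to $C(X)$ for some continuum $X$. A model $M \models T_{\mathrm{conn}}$ is existentially closed if for every $N \models T_{\mathrm{conn}}$ with $M \subseteq N$, every quantifier-free formula $\phi(\overline{x},\overline{y})$ and every tuple $\overline{b}$ from $M$, $(\inf_{\overline{x}}\phi(\overline{x},\overline{b}))^M = (\inf_{\overline{x}}\phi(\overline{x},\overline{b}))^N$. A continuum $X$ is co-existentially closed if $C(X)$ is an existentially closed model of $T_{\mathrm{conn}}$.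
   Formalization: Y is assumed to have at least two points; for the one-point continuum the claim is false, since w(X) = 1 forces X to be a point and C(X) = ℂ is not existentially closed. *)

(* Defs.v *)
From HB Require Import structures.
From mathcomp Require Import all_boot all_order all_algebra generic_quotient.
From mathcomp Require Import complex.
From mathcomp Require Import all_classical all_reals all_analysis.

Set Implicit Arguments.
Unset Strict Implicit.
Unset Printing Implicit Defensive.
Import Order.TTheory GRing.Theory Num.Theory.
Import numFieldNormedType.Exports.
Local Open Scope classical_set_scope.
Local Open Scope card_scope.
Local Open Scope ring_scope.
Local Open Scope quotient_scope.

Definition continuum (X : topologicalType) : Prop :=
  [/\ [set: X] !=set0, hausdorff_space X, compact [set: X]
    & connected [set: X]].

(* Meant for Hausdorff ambient spaces, where a subspace is automatically
   Hausdorff. *)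
Definition subcontinuum (X : topologicalType) (K : set X) : Prop :=
  [/\ K !=set0, compact K & connected K].

Definition hereditarily_indecomposable (X : topologicalType) : Prop :=
  forall K A B : set X, subcontinuum K -> subcontinuum A -> subcontinuum B ->
    K = A `|` B -> A = K \/ B = K.

(* The weight as a cardinal is represented by any base of minimal cardinality. *)
Definition minimal_basis (X : topologicalType) (B : set (set X)) : Prop :=
  basis B /\ forall B' : set (set X), basis B' -> B #<= B'.

Definition same_weight (X Y : topologicalType) : Prop :=
  exists (A : set (set X)) (B : set (set Y)),
    [/\ minimal_basis A, minimal_basis B & A #= B].

Definition Zindependent (G : zmodType) (S : set G) : Prop :=
  forall (s : seq G) (k : G -> int), uniq s -> [set` s] `<=` S ->
    \sum_(g <- s) g *~ k g = 0 -> forall g, g \in s -> k g = 0.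

Definition maximal_Zindependent (G : zmodType) (S : set G) : Prop :=
  Zindependent S /\
  forall S' : set G, Zindependent S' -> S `<=` S' -> S' = S.

(* rank G <= rank H, a rank being represented by a maximal independent set. *)
Definition rank_le (G H : zmodType) : Prop :=
  exists (S : set G) (T : set H),
    [/\ maximal_Zindependent S, maximal_Zindependent T & S #<= T].

(* First integral Cech cohomology: the direct limit, over all open covers
   ordered by refinement, of H^1 of the nerve.  A 1-cochain on the nerve of [cov]
   is given by its values on ordered pairs of members of [cov] that meet; its
   other values are junk that [cohomologous] ignores. *)
Section Cech.
Variable X : topologicalType.
Implicit Types (U V W : set (set X)) (c : set X -> set X -> int).

Definition open_covering U : Prop :=
  (forall u, U u -> open u) /\ \bigcup_(u in U) u = [set: X].

Definition cocycle U c : Prop := forall u v w, U u -> U v -> U w ->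
  u `&` v `&` w !=set0 -> c u v + c v w = c u w.

Definition cohomologous U c c' : Prop := exists b : set X -> int,
  forall u v, U u -> U v -> u `&` v !=set0 -> c' u v - c u v = b v - b u.

Definition refinement_map W U (r : set X -> set X) : Prop :=
  forall w, W w -> U (r w) /\ w `<=` r w.

Definition pullback (r : set X -> set X) c : set X -> set X -> int :=
  fun u v => c (r u) (r v).

Record cech_cocycle := CechCocycle {
  cech_cov : set (set X);
  cech_val : set X -> set X -> int;
  cech_covP : open_covering cech_cov;
  cech_valP : cocycle cech_cov cech_val }.

HB.instance Definition _ := gen_eqMixin cech_cocycle.
HB.instance Definition _ := gen_choiceMixin cech_cocycle.

Definition cech_equiv (z z' : cech_cocycle) : Prop :=
  exists W r r', [/\ open_covering W,
    refinement_map W (cech_cov z) r, refinement_map W (cech_cov z') r'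
  & cohomologous W (pullback r (cech_val z)) (pullback r' (cech_val z'))].

Definition cov_refines W U : Prop := exists r, refinement_map W U r.

Definition refmap W U : set X -> set X :=
  fun w => xget set0 [set u | U u /\ w `<=` u].

Definition meet_cov U V : set (set X) :=
  [set w | exists u v, [/\ U u, V v & w = u `&` v]].

Definition cech_val_add c c' : set X -> set X -> int := fun u v => c u v + c' u v.
Definition cech_val_opp c : set X -> set X -> int := fun u v => - c u v.
Definition cech_val_zero : set X -> set X -> int := fun _ _ => 0.

Lemma refmapP W U : cov_refines W U -> refinement_map W U (refmap W U).
Proof.
move=> [r rP] w Ww.
by apply: (@xgetPex _ set0 [set u | U u /\ w `<=` u]); exists (r w); exact: rP.
Qed.

Lemma cov_refines_refl W : cov_refines W W.
Proof. by exists id => w Ww; split. Qed.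

Lemma cov_refines_trans U V W : cov_refines W V -> cov_refines V U -> cov_refines W U.
Proof.
move=> [r rP] [s sP]; exists (s \o r) => w /rP [Vr wr] /=.
by have [? rs] := sP _ Vr; split=> // x /wr/rs.
Qed.

Lemma cov_refines_ex W U :
  (forall w, W w -> exists u, U u /\ w `<=` u) -> cov_refines W U.
Proof.
move=> h; exists (refmap W U) => w /h.
exact: (@xgetPex _ set0 [set u | U u /\ w `<=` u]).
Qed.

Lemma cov_refines_meetl U V : cov_refines (meet_cov U V) U.
Proof.
apply: cov_refines_ex => w [u [v [Uu Vv ->]]].
by exists u; split=> // x [].
Qed.

Lemma cov_refines_meetr U V : cov_refines (meet_cov U V) V.
Proof.
apply: cov_refines_ex => w [u [v [Uu Vv ->]]].
by exists v; split=> // x [].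
Qed.

Lemma meet_cov_open U V :
  open_covering U -> open_covering V -> open_covering (meet_cov U V).
Proof.
move=> [oU cU] [oV cV]; split=> [w [u [v [Uu Vv ->]]]|].
  by apply: openI; [exact: oU|exact: oV].
rewrite -subTset => x _.
have [u Uu ux] : (\bigcup_(u in U) u) x by rewrite cU.
have [v Vv vx] : (\bigcup_(v in V) v) x by rewrite cV.
by exists (u `&` v) => //; exists u, v.
Qed.

Lemma coh_eq W c c' : c =2 c' -> cohomologous W c c'.
Proof. by move=> e; exists (fun=> 0) => u v *; rewrite e !subrr. Qed.

Lemma coh_refl W c : cohomologous W c c.
Proof. exact: coh_eq. Qed.

Lemma coh_sym W c c' : cohomologous W c c' -> cohomologous W c' c.
Proof.
move=> [b bP]; exists (fun u => - b u) => u v Wu Wv uv.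
by rewrite -opprB bP// opprB opprK addrC.
Qed.

Lemma coh_trans W c c' c'' :
  cohomologous W c c' -> cohomologous W c' c'' -> cohomologous W c c''.
Proof.
move=> [b bP] [d dP]; exists (fun u => b u + d u) => u v Wu Wv uv.
rewrite opprD addrACA -bP// -dP//.
by rewrite [RHS]addrC addrA subrK.
Qed.

Lemma coh_add W c1 c1' c2 c2' : cohomologous W c1 c1' ->
  cohomologous W c2 c2' -> cohomologous W (cech_val_add c1 c2) (cech_val_add c1' c2').
Proof.
move=> [b bP] [d dP]; exists (fun u => b u + d u) => u v Wu Wv uv.
by rewrite /cech_val_add !opprD addrACA [RHS]addrACA -bP// -dP.
Qed.

Lemma coh_opp W c c' :
  cohomologous W c c' -> cohomologous W (cech_val_opp c) (cech_val_opp c').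
Proof.
move=> [b bP]; exists (fun u => - b u) => u v Wu Wv uv.
by rewrite /cech_val_opp -!opprD bP.
Qed.

Lemma coh_pull W U r c c' : refinement_map W U r ->
  cohomologous U c c' -> cohomologous W (pullback r c) (pullback r c').
Proof.
move=> rP [b bP]; exists (b \o r) => u v Wu Wv [x [ux vx]] /=.
have [Uu uu] := rP _ Wu; have [Uv vv] := rP _ Wv.
by rewrite /pullback bP//; exists x; split; [exact: uu|exact: vv].
Qed.

Lemma coh_indep W U r s c : cocycle U c ->
  refinement_map W U r -> refinement_map W U s ->
  cohomologous W (pullback r c) (pullback s c).
Proof.
move=> cP rP sP; exists (fun w => c (r w) (s w)) => u v Wu Wv [x [ux vx]].
have [Ur ur] := rP _ Wu; have [Us us] := sP _ Wu.
have [Vr vr] := rP _ Wv; have [Vs vs] := sP _ Wv.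
rewrite /pullback; apply/eqP; rewrite subr_eq addrAC eq_sym subr_eq.
rewrite [X in _ == X]addrC [X in X == _]addrC.
have pt (a b d : set X) : a x -> b x -> d x -> a `&` b `&` d !=set0.
  by move=> *; exists x.
by rewrite !cP//; apply: pt; auto.
Qed.

Definition cech_res W (z : cech_cocycle) : set X -> set X -> int :=
  pullback (refmap W (cech_cov z)) (cech_val z).

Lemma res_map W z r : refinement_map W (cech_cov z) r ->
  cohomologous W (cech_res W z) (pullback r (cech_val z)).
Proof.
move=> rP; apply: (coh_indep (@cech_valP z)) => //.
by apply: refmapP; exists r.
Qed.

Lemma res_res W W' z : cov_refines W' W -> cov_refines W (cech_cov z) ->
  cohomologous W' (cech_res W' z) (pullback (refmap W' W) (cech_res W z)).
Proof.
move=> /refmapP sP /refmapP rP.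
apply: (@res_map W' z (refmap W (cech_cov z) \o refmap W' W)) => w /sP [Ww wW] /=.
by have [? rs] := rP _ Ww; split=> // x /wW /rs.
Qed.

Lemma cech_equivP z z' : cech_equiv z z' <->
  exists W, [/\ open_covering W, cov_refines W (cech_cov z),
    cov_refines W (cech_cov z') & cohomologous W (cech_res W z) (cech_res W z')].
Proof.
split=> [[W [r [r' [oW rP rP' h]]]]|[W [oW rP rP' h]]].
  exists W; split=> //; [by exists r|by exists r'|].
  apply: coh_trans (res_map rP) _; apply: coh_trans h _.
  exact/coh_sym/res_map.
exists W, (refmap W (cech_cov z)), (refmap W (cech_cov z')).
by split=> //; exact: refmapP.
Qed.

Lemma coh_finer W W' z z' : cov_refines W' W -> cov_refines W (cech_cov z) ->
  cov_refines W (cech_cov z') -> cohomologous W (cech_res W z) (cech_res W z') ->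
  cohomologous W' (cech_res W' z) (cech_res W' z').
Proof.
move=> W'W Wz Wz' h; apply: coh_trans (res_res W'W Wz) _.
apply: coh_trans (coh_sym (res_res W'W Wz')).
exact: coh_pull (refmapP W'W) h.
Qed.

Lemma cech_equiv_refl z : cech_equiv z z.
Proof.
apply/cech_equivP; exists (cech_cov z); split; [exact: cech_covP| | |].
- exact: cov_refines_refl.
- exact: cov_refines_refl.
- exact: coh_refl.
Qed.

Lemma cech_equiv_sym z z' : cech_equiv z z' -> cech_equiv z' z.
Proof.
by move=> /cech_equivP[W [? ? ? /coh_sym h]]; apply/cech_equivP; exists W.
Qed.

Lemma cech_equiv_trans z z' z'' :
  cech_equiv z z' -> cech_equiv z' z'' -> cech_equiv z z''.
Proof.
move=> /cech_equivP[W [oW Wz Wz' h]] /cech_equivP[V [oV Vz Vz' k]].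
have mW := cov_refines_meetl W V; have mV := cov_refines_meetr W V.
apply/cech_equivP; exists (meet_cov W V); split.
- exact: meet_cov_open.
- exact: cov_refines_trans mW _.
- exact: cov_refines_trans mV _.
- exact: coh_trans (coh_finer mW Wz Wz' h) (coh_finer mV Vz Vz' k).
Qed.

Lemma cech_is_equiv :
  equiv_class_of (fun z z' : cech_cocycle => `[<cech_equiv z z'>]).
Proof.
split=> [z|z z'|z z' z''].
- by apply/asboolP/cech_equiv_refl.
- by apply/asboolP/asboolP; exact: cech_equiv_sym.
- by move=> /asboolP zz' /asboolP z'z''; apply/asboolP/(cech_equiv_trans zz').
Qed.

Canonical cech_equiv_rel := EquivRelPack cech_is_equiv.

Definition cechH1 := {eq_quot cech_equiv_rel}.
HB.instance Definition _ := Choice.on cechH1.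
HB.instance Definition _ := EqQuotient.on cechH1.

Lemma cechH1_eq (z z' : cech_cocycle) :
  \pi_cechH1 z = \pi_cechH1 z' <-> cech_equiv z z'.
Proof. by split=> [/eqmodP/asboolP//|h]; apply/eqmodP/asboolP. Qed.

Lemma cech_add_valP z z' : let W := meet_cov (cech_cov z) (cech_cov z') in
  cocycle W (cech_val_add (cech_res W z) (cech_res W z')).
Proof.
move=> W u v w Wu Wv Ww [x [[ux vx] wx]].
have mz : cov_refines W (cech_cov z) := cov_refines_meetl _ _.
have mz' : cov_refines W (cech_cov z') := cov_refines_meetr _ _.
have aux y : cov_refines W (cech_cov y) -> cech_res W y u v + cech_res W y v w = cech_res W y u w.
  move=> /refmapP rP; rewrite /cech_res /pullback.
  have [? uu] := rP _ Wu; have [? vv] := rP _ Wv; have [? ww] := rP _ Ww.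
  by apply: cech_valP => //; exists x; split; [split; [exact: uu|exact: vv]|exact: ww].
by rewrite /cech_val_add addrACA !aux.
Qed.

Definition cech_add z z' : cech_cocycle :=
  CechCocycle (meet_cov_open (cech_covP z) (cech_covP z')) (@cech_add_valP z z').

Lemma cech_opp_valP z : cocycle (cech_cov z) (cech_val_opp (cech_val z)).
Proof. by move=> u v w *; rewrite /cech_val_opp -opprD (@cech_valP z). Qed.

Definition cech_opp z : cech_cocycle :=
  CechCocycle (cech_covP z) (@cech_opp_valP z).

Lemma cech_zero_covP : open_covering [set [set: X]].
Proof. by split=> [u -> |]; [exact: openT|rewrite bigcup_set1]. Qed.

Lemma cech_zero_valP : cocycle [set [set: X]] cech_val_zero.
Proof. by move=> u v w *; rewrite addr0. Qed.

Definition cech_zero : cech_cocycle := CechCocycle cech_zero_covP cech_zero_valP.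

Lemma res_add W z z' : cov_refines W (cech_cov (cech_add z z')) ->
  cohomologous W (cech_res W (cech_add z z')) (cech_val_add (cech_res W z) (cech_res W z')).
Proof.
move=> h; have rP := refmapP h.
set M := meet_cov (cech_cov z) (cech_cov z') in h rP.
by apply: coh_add; apply/coh_sym/res_res => //;
  [exact: cov_refines_meetl|exact: cov_refines_meetr].
Qed.

Lemma res_opp W z : cohomologous W (cech_res W (cech_opp z)) (cech_val_opp (cech_res W z)).
Proof. exact: coh_refl. Qed.

Lemma cov_refines_addl W z z' :
  cov_refines W (cech_cov (cech_add z z')) -> cov_refines W (cech_cov z).
Proof. by move=> h; apply: cov_refines_trans h (cov_refines_meetl _ _). Qed.

Lemma cov_refines_addr W z z' :
  cov_refines W (cech_cov (cech_add z z')) -> cov_refines W (cech_cov z').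
Proof. by move=> h; apply: cov_refines_trans h (cov_refines_meetr _ _). Qed.

(* It suffices to compare two cocycles on a cover refining both of theirs. *)
Lemma cech_equiv_common z z' :
  (forall W, cov_refines W (cech_cov z) -> cov_refines W (cech_cov z') ->
    cohomologous W (cech_res W z) (cech_res W z')) -> cech_equiv z z'.
Proof.
move=> h; have mz := cov_refines_meetl (cech_cov z) (cech_cov z').
have mz' := cov_refines_meetr (cech_cov z) (cech_cov z').
apply/cech_equivP; exists (meet_cov (cech_cov z) (cech_cov z')); split=> //.
- exact: meet_cov_open (cech_covP z) (cech_covP z').
- exact: h.
Qed.

Lemma cech_add_equiv z1 z1' z2 z2' : cech_equiv z1 z1' -> cech_equiv z2 z2' ->
  cech_equiv (cech_add z1 z2) (cech_add z1' z2').
Proof.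
move=> /cech_equivP[W [oW W1 W1' h]] /cech_equivP[V [oV V2 V2' k]].
set A := meet_cov W V; set B := meet_cov (cech_cov (cech_add z1 z2))
  (cech_cov (cech_add z1' z2')).
have AW : cov_refines (meet_cov A B) W.
  exact: cov_refines_trans (cov_refines_meetl _ _) (cov_refines_meetl _ _).
have AV : cov_refines (meet_cov A B) V.
  exact: cov_refines_trans (cov_refines_meetl _ _) (cov_refines_meetr _ _).
have B1 : cov_refines (meet_cov A B) (cech_cov (cech_add z1 z2)).
  exact: cov_refines_trans (cov_refines_meetr _ _) (cov_refines_meetl _ _).
have B2 : cov_refines (meet_cov A B) (cech_cov (cech_add z1' z2')).
  exact: cov_refines_trans (cov_refines_meetr _ _) (cov_refines_meetr _ _).
apply/cech_equivP; exists (meet_cov A B); split=> //.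
  apply: meet_cov_open; apply: meet_cov_open => //; exact: cech_covP.
apply: coh_trans (res_add B1) _; apply: coh_trans (coh_sym (res_add B2)).
by apply: coh_add; [exact: coh_finer AW _ _ h|exact: coh_finer AV _ _ k].
Qed.

Lemma cech_opp_equiv z z' :
  cech_equiv z z' -> cech_equiv (cech_opp z) (cech_opp z').
Proof.
move=> /cech_equivP[W [oW Wz Wz' h]]; apply/cech_equivP; exists W; split=> //.
exact: coh_opp.
Qed.

Definition H1add (a b : cechH1) : cechH1 :=
  \pi_cechH1 (cech_add (repr a) (repr b)).
Definition H1opp (a : cechH1) : cechH1 := \pi_cechH1 (cech_opp (repr a)).
Definition H1zero : cechH1 := \pi_cechH1 cech_zero.

Lemma cech_repr z : cech_equiv (repr (\pi_cechH1 z)) z.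
Proof. by apply/cechH1_eq; rewrite reprK. Qed.

Lemma H1add_pi z z' :
  H1add (\pi_cechH1 z) (\pi_cechH1 z') = \pi_cechH1 (cech_add z z').
Proof. by apply/cechH1_eq/cech_add_equiv; exact: cech_repr. Qed.

Lemma H1opp_pi z : H1opp (\pi_cechH1 z) = \pi_cechH1 (cech_opp z).
Proof. by apply/cechH1_eq/cech_opp_equiv; exact: cech_repr. Qed.

Lemma H1addA : associative H1add.
Proof.
elim/quotW=> a; elim/quotW=> b; elim/quotW=> c.
rewrite (H1add_pi b c) (H1add_pi a b) !H1add_pi.
apply/cechH1_eq/cech_equiv_common => W h k.
apply: coh_trans (res_add h) _; apply: coh_trans (coh_sym (res_add k)).
apply: coh_trans (coh_add (coh_refl _ _) (res_add (cov_refines_addr h))) _.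
apply: coh_trans (coh_add (coh_sym (res_add (cov_refines_addl k))) (coh_refl _ _)).
by apply: coh_eq => u v; rewrite /cech_val_add addrA.
Qed.

Lemma H1addC : commutative H1add.
Proof.
elim/quotW=> a; elim/quotW=> b; rewrite !H1add_pi.
apply/cechH1_eq/cech_equiv_common => W h k.
apply: coh_trans (res_add h) _; apply: coh_trans (coh_sym (res_add k)).
by apply: coh_eq => u v; rewrite /cech_val_add addrC.
Qed.

Lemma H1add0 : left_id H1zero H1add.
Proof.
elim/quotW=> a; rewrite H1add_pi.
apply/cechH1_eq/cech_equiv_common => W h k.
apply: coh_trans (res_add h) _.
by apply: coh_eq => u v; rewrite /cech_val_add add0r.
Qed.

Lemma H1addN : left_inverse H1zero H1opp H1add.
Proof.
elim/quotW=> a; rewrite H1opp_pi H1add_pi.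
apply/cechH1_eq/cech_equiv_common => W h k.
apply: coh_trans (res_add h) _.
apply: coh_eq => u v; exact: addNr.
Qed.

HB.instance Definition _ := GRing.isZmodule.Build cechH1 H1addA H1addC H1add0 H1addN.

End Cech.

Section ContinuousLogic.
Variable R : realType.

(* Interpretations of the language of unital C*-algebras. *)
Record cstar_structure := CstarStructure {
  cs_sort :> Type;
  cs_zero : cs_sort;
  cs_one : cs_sort;
  cs_add : cs_sort -> cs_sort -> cs_sort;
  cs_mul : cs_sort -> cs_sort -> cs_sort;
  cs_scale : R[i] -> cs_sort -> cs_sort;
  cs_star : cs_sort -> cs_sort;
  cs_norm : cs_sort -> R }.

Record cstar_embedding (A B : cstar_structure) (j : A -> B) : Prop := {
  emb_inj : injective j;
  emb_zero : j (cs_zero A) = cs_zero B;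
  emb_one : j (cs_one A) = cs_one B;
  emb_add : forall x y, j (cs_add x y) = cs_add (j x) (j y);
  emb_mul : forall x y, j (cs_mul x y) = cs_mul (j x) (j y);
  emb_scale : forall a x, j (cs_scale a x) = cs_scale a (j x);
  emb_star : forall x, j (cs_star x) = cs_star (j x);
  emb_norm : forall x, cs_norm (j x) = cs_norm x }.

Definition cstar_isomorphic (A B : cstar_structure) : Prop :=
  exists j : A -> B, cstar_embedding j /\ bijective j.

Inductive cstar_term (V : Type) : Type :=
| TVar of V
| TZero
| TOne
| TAdd of cstar_term V & cstar_term V
| TMul of cstar_term V & cstar_term V
| TScale of R[i] & cstar_term V
| TStar of cstar_term V.

Fixpoint term_eval (A : cstar_structure) (V : Type) (e : V -> A)
    (t : cstar_term V) : A :=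
  match t with
  | TVar v => e v
  | TZero => cs_zero A
  | TOne => cs_one A
  | TAdd t1 t2 => cs_add (term_eval e t1) (term_eval e t2)
  | TMul t1 t2 => cs_mul (term_eval e t1) (term_eval e t2)
  | TScale a t1 => cs_scale a (term_eval e t1)
  | TStar t1 => cs_star (term_eval e t1)
  end.

Inductive qf_formula (V : Type) : Type :=
| QFNorm of cstar_term V
| QFConnective (n : nat) (f : 'rV[R]_n -> R) of continuous f
    & ('I_n -> qf_formula V).

Fixpoint qf_eval (A : cstar_structure) (V : Type) (e : V -> A)
    (phi : qf_formula V) : R :=
  match phi with
  | QFNorm t => cs_norm (term_eval e t)
  | QFConnective n f _ phis => f (\row_(i < n) qf_eval e (phis i))
  end.

Definition join_tuples (A : Type) (n m : nat) (x : 'I_n -> A) (b : 'I_m -> A)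
    (v : 'I_n + 'I_m) : A :=
  match v with inl i => x i | inr k => b k end.

(* In the continuous logic of C*-algebras the domains of quantification are the
   closed balls of integer radius, so that each quantified variable x_i carries a
   radius r_i. *)
Definition inf_formula (A : cstar_structure) (n m : nat) (r : 'I_n -> nat)
    (phi : qf_formula ('I_n + 'I_m)) (b : 'I_m -> A) : \bar R :=
  ereal_inf [set (qf_eval (join_tuples x b) phi)%:E
            | x in [set x : 'I_n -> A | forall i, cs_norm (x i) <= (r i)%:R]].

Section ContinuousFunctions.
Variable X : topologicalType.
Local Notation C := (R[i] : numClosedFieldType).
Local Notation CX := (continuousType X C).

Lemma cts_addP (f g : CX) : continuous (fun x => f x + g x : C).
Proof. by move=> x; apply: cvgD; exact: cts_fun. Qed.

Lemma cts_mulP (f g : CX) : continuous (fun x => f x * g x : C).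
Proof. by move=> x; apply: cvgM; exact: cts_fun. Qed.

Lemma cts_scaleP (a : R[i]) (f : CX) : continuous (fun x => a * f x : C).
Proof. by move=> x; apply: cvgM; [exact: cvg_cst|exact: cts_fun]. Qed.

Lemma cts_conjP (f : CX) : continuous (fun x => conjc (f x) : C).
Proof.
move=> x; apply/cvgrPdist_lt => e e0.
have /cvgrPdist_lt/(_ e e0) := @cts_fun _ _ f x.
by apply: filterS => y; rewrite -rmorphB normcJ.
Qed.

Definition cts_algebra : cstar_structure := {|
  cs_sort := CX;
  cs_zero := (cst (0 : C) : CX);
  cs_one := (cst (1 : C) : CX);
  cs_add := fun f g => (mkcts (@cts_addP f g) : CX);
  cs_mul := fun f g => (mkcts (@cts_mulP f g) : CX);
  cs_scale := fun a f => (mkcts (@cts_scaleP a f) : CX);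
  cs_star := fun f => (mkcts (@cts_conjP f) : CX);
  cs_norm := fun f => sup (range (fun x => ComplexField.Normc.normc (f x))) |}.

End ContinuousFunctions.

(* The models of T_conn.  Being isomorphic to some C(X) subsumes the C*-algebra
   axioms, which is why [cstar_structure] does not carry them. *)
Definition Tconn_model (A : cstar_structure) : Prop :=
  exists X : topologicalType, continuum X /\ cstar_isomorphic A (cts_algebra X).

Definition existentially_closed (M : cstar_structure) : Prop :=
  Tconn_model M /\
  forall (N : cstar_structure) (j : M -> N),
    Tconn_model N -> cstar_embedding j ->
  forall (n m : nat) (r : 'I_n -> nat) (phi : qf_formula ('I_n + 'I_m))
    (b : 'I_m -> M),
    inf_formula r phi b = inf_formula r phi (j \o b).

Definition co_existentially_closed (X : topologicalType) : Prop :=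
  continuum X /\ existentially_closed (cts_algebra X).

End ContinuousLogic.

(* Main.v *)
From HB Require Import structures.
Require Import Defs.
From mathcomp Require Import all_boot all_order all_algebra generic_quotient.
From mathcomp Require Import complex lra.
From mathcomp Require Import all_classical all_reals all_analysis.

(* By Gelfand duality, X is co-existentially closed as soon as, for every continuum
   Z over X and every tuple z of bounded functions on Z, some tuple x on X has a
   graph in X * C^n arbitrarily close, in the Vietoris topology, to the image of Z:
   the value of a quantifier-free formula only depends on this image, and
   continuously so.  This asks X to meet a family of requirements, each given by
   finitely many basic boxes, hence indexed by a set I of the cardinality of a base
   of Y.  In Y times a product of discs with a block of coordinates for each index,
   a Zorn argument on pairs (satisfied indices, subcontinuum) yields a maximal
   continuum; it meets every requirement that some continuum over it meets, and
   its weight is that of Y.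

   The projection f : X -> Y is injective on H^1.  A class on Y defines a covering
   space E of Y with group Z, embedded in Y * R by a partition of unity; if f kills
   the class, f lifts to X -> E.  Since Y is hereditarily indecomposable, every
   subcontinuum of E projects injectively to Y, so the image of X is a section of E
   and the class is zero. *)

Set Implicit Arguments.
Unset Strict Implicit.
Unset Printing Implicit Defensive.
Import Order.TTheory GRing.Theory Num.Theory.
Import numFieldNormedType.Exports.
Local Open Scope classical_set_scope.
Local Open Scope card_scope.
Local Open Scope ring_scope.

(** * Cardinal arithmetic *)

(** The obstacle is a circularity: requirements are phrased with boxes of [P], and the coordinates
    of [P] are indexed by the requirements. A requirement therefore counts as satisfied only when
    its boxes use coordinates already filled, and [dec] maps [I] onto the finite lists of boxes.
    Such a surjection exists because an infinite set absorbs products and finite sequences; a base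
    of [Y] is infinite since [Y] is connected, Hausdorff and has two points. Unfilled coordinates
    are pinned at a base point, so all stages live in one product. The witness [Z] may be
    arbitrarily large, but only its image in this product is adjoined, so the weight does not grow;
    it does not drop either, since a surjection of compacta never raises the weight.

    On the cohomological side, [E] is not compact and its subcontinua are not known to be
    indecomposable. The hypothesis on [Y] can be exploited only through projections of pieces
    already known to be injective over [Y]; hence the argument on a minimal counterexample, whose
    proper subcontinua all are. *)

Lemma card_leI T U (A : set T) (B : set U) (f : T -> U) :
  (forall x, A x -> B (f x)) ->
  (forall x y, A x -> A y -> f x = f y -> x = y) -> A #<= B.
Proof.
move=> fAB fI; have fAsub : f @` A `<=` B by move=> _ [x Ax <-]; exact: fAB.
apply: card_le_trans (subset_card_le fAsub).
have fI' : {in A &, injective f} by move=> x y /set_mem Ax /set_mem Ay; exact: fI.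
by have /card_esym := inj_card_eq fI'; rewrite card_eq_le => /andP[].
Qed.

Lemma card_leE T U (A : set T) (B : set U) (u0 : U) : A #<= B ->
  exists2 f : T -> U, forall x, A x -> B (f x) &
    forall x y, A x -> A y -> f x = f y -> x = y.
Proof.
move=> /card_leP[f].
pose g x := if pselect (A x) is left Ax then set_val (f (SigSub (mem_set Ax))) else u0.
exists g => [x Ax|x y Ax Ay]; rewrite /g.
  by case: pselect => // Ax'; exact: set_valP.
case: pselect => // Ax'; case: pselect => // Ay' /val_inj fE.
have := @inj _ _ _ f (SigSub (mem_set Ax')) (SigSub (mem_set Ay')).
by rewrite !inE => /(_ I I fE) /(congr1 val).
Qed.

(* A maximal set of functions [s] choosing a point [s B] in each member [B] of
   [F], injectively in each coordinate, exhausts some member. *)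
Lemma card_min T (F : set (set T)) : F !=set0 ->
  exists2 B, F B & forall B', F B' -> B #<= B'.
Proof.
move=> [B0 FB0].
pose P (S : set (set T -> T)) := (forall s B, S s -> F B -> B (s B)) /\
  (forall s s' B, S s -> S s' -> F B -> s B = s' B -> s = s').
have [|S [[Sin Sinj] Smax]] := @Zorn_bigcup _ P.
  move=> G GP totG; split=> [s B [S GS Ss] FB|s s' B [S GS Ss] [S' GS' Ss'] FB].
    by have [h _] := GP _ GS; exact: (h s B Ss FB).
  have [SS|SS] := totG _ _ GS GS'.
    by have [_ h] := GP _ GS'; apply: h => //; exact: SS.
  by have [_ h] := GP _ GS; apply: h => //; exact: SS.
have [B FB BS] : exists2 B, F B & forall b, B b -> exists2 s, S s & s B = b.
  apply: contrapT => nB.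
  have missed B : F B -> exists b, B b /\ forall s, S s -> s B <> b.
    move=> FB; apply: contrapT => nb; apply: nB; exists B => // b Bb.
    apply: contrapT => ns; apply: nb; exists b; split=> // s Ss sb.
    by apply: ns; exists s.
  have [b0 _] := missed _ FB0.
  have /choice[s sP] : forall B, exists b, F B -> B b /\ forall s, S s -> s B <> b.
    move=> B; have [/missed[b bP]|nF] := pselect (F B); first by exists b.
    by exists b0.
  case: (Smax (s |` S)).
    split; first exact: subsetUr.
    by move=> /(_ s (or_introl erefl)) Ss; have [_ /(_ s Ss)] := sP _ FB0.
  split=> [t B [->|St] FB|s1 s2 B]; [by have [] := sP _ FB|exact: (Sin t B St FB)|].
  move=> [->|S1] [->|S2] FB // e; last exact: Sinj e.
    by have [_ /(_ _ S2)] := sP _ FB; rewrite e.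
  by have [_ /(_ _ S1)] := sP _ FB; rewrite e.
exists B => // B' FB'.
have [[s0 Ss0]|S0] := pselect (S !=set0); last first.
  by apply: (@card_leI _ _ _ _ id) => // b /BS[s Ss]; case: S0; exists s.
have /choice[m mP] : forall b, exists s, B b -> S s /\ s B = b.
  move=> b; have [/BS[s Ss sb]|nb] := pselect (B b); first by exists s.
  by exists s0.
apply: (@card_leI _ _ _ _ (fun b => m b B')) => [b Bb|b b' Bb Bb' e].
  by have [Sm _] := mP _ Bb; exact: (Sin _ B' Sm FB').
have [Sm mb] := mP _ Bb; have [Sm' mb'] := mP _ Bb'.
by rewrite -mb -mb' (Sinj _ _ _ Sm Sm' FB' e).
Qed.

Lemma card_le_or T (A B : set T) : A #<= B \/ B #<= A.
Proof.
have [|C CAB Cmin] := @card_min T [set A; B]; first by exists A; left.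
by case: CAB Cmin => -> Cmin; [left|right]; apply: Cmin; [right|left].
Qed.

Lemma infinite_set_type T (A : set T) : infinite_set A -> infinite_set [set: set_type A].
Proof.
move=> infA fA; apply: infA; apply: card_le_finite fA.
by have := card_setT_sym A; rewrite card_eq_le => /andP[].
Qed.

(** * Hessenberg's theorem on the square of an infinite set *)

Section InfiniteSquare.
Variable K : Type.
Implicit Types (G : set (K * K * K)) (x y z : K).

(** Reading the domain off the diagonal lets the graph alone carry both a set and an injection of
    its square into it, so that Zorn's lemma runs on graphs ordered by inclusion. *)
Definition sq_dom G : set K := [set x | exists z, G (x, x, z)].

Definition sq_graph G := [/\
  forall x y z z', G (x, y, z) -> G (x, y, z') -> z = z',
  forall x y x' y' z, G (x, y, z) -> G (x', y', z) -> x = x' /\ y = y',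
  forall x y z, G (x, y, z) -> [/\ sq_dom G x, sq_dom G y & sq_dom G z] &
  forall x y, sq_dom G x -> sq_dom G y -> exists z, G (x, y, z)].

(** Each axiom involves at most two triples, and two triples of the union of a chain lie in a common
    member. *)
Lemma sq_graph_bigcup (F : set (set (K * K * K))) :
  F `<=` sq_graph -> total_on F subset -> sq_graph (\bigcup_(G in F) G).
Proof.
move=> FP totF.
have join G G' : F G -> F G' -> exists H, [/\ F H, G `<=` H & G' `<=` H].
  by move=> FG FG'; have [GG|GG] := totF _ _ FG FG'; [exists G'|exists G]; split.
have domS G : F G -> sq_dom G `<=` sq_dom (\bigcup_(G in F) G).
  by move=> FG x [z Gz]; exists z, G.
split=> [x y z z'|x y x' y' z|x y z|x y].
- move=> [G FG Gz] [G' FG' Gz']; have [H [FH GH GH']] := join _ _ FG FG'.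
  by have [h _ _ _] := FP _ FH; exact: (h x y z z' (GH _ Gz) (GH' _ Gz')).
- move=> [G FG Gz] [G' FG' Gz']; have [H [FH GH GH']] := join _ _ FG FG'.
  by have [_ h _ _] := FP _ FH; exact: (h x y x' y' z (GH _ Gz) (GH' _ Gz')).
- move=> [G FG Gz]; have [_ _ /(_ _ _ _ Gz)[dx dy dz] _] := FP _ FG.
  by split; apply: domS FG _ _.
- move=> [z [G FG Gz]] [z' [G' FG' Gz']]; have [H [FH GH GH']] := join _ _ FG FG'.
  have [_ _ _ /(_ x y)[||w Hw]] := FP _ FH; [by exists z; exact: GH|by exists z'; exact: GH'|].
  by exists w, H.
Qed.

(** A maximal graph has a domain [A] that absorbs its complement: otherwise the complement contains
    a copy of [A], over which the graph can be extended. Once the complement embeds into [A], so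
    does the whole of [K], and the injection on the square of [A] finishes. *)
Lemma infinite_square : infinite_set [set: K] ->
  exists f : K * K -> K, injective f.
Proof.
move=> /infiniteP infK.
have [k0 _] : exists k : K, True.
  by have /card_leP[f] := infK; exists (set_val (f (SigSub (mem_set (I : [set: nat] 0%N))))).
have [u _ uI] := card_leE k0 infK.
have {}uI m n : u m = u n -> m = n by exact: uI.
(* A copy of the pairing of natural numbers: it gives Zorn's lemma a starting point and keeps [u 0],
   [u 1], [u 2] in the domain as tags. *)
pose G0 : set (K * K * K) := [set t | exists m n, t = (u m, u n, u (pickle (m, n)))].
have domG0 x : sq_dom G0 x <-> exists n, x = u n.
  split=> [[z [m [n [-> _ _]]]]|[n ->]]; first by exists m.
  by exists (u (pickle (n, n))), n, n.
have gG0 : sq_graph G0.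
  split=> [x y z z' [m [n [-> -> ->]]] [m' [n' [/uI -> /uI -> ->]]]//|||].
  - move=> x y x' y' z [m [n [-> -> ->]]] [m' [n' [-> -> /uI]]].
    by move=> /(pcan_inj pickleK)[-> ->].
  - by move=> x y z [m [n [-> -> ->]]]; split; apply/domG0; eexists.
  - by move=> x y /domG0[m ->] /domG0[n ->]; exists (u (pickle (m, n))), m, n.
(* With [G0] adjoined throughout, the maximal graph contains it and the empty chain causes no
   trouble. *)
have [|G [gG Gmax]] := @Zorn_bigcup _ [set G | sq_graph (G0 `|` G)].
  move=> F FP totF; have [[G1 FG1]|F0] := pselect (F !=set0); last first.
    rewrite /= (_ : \bigcup_(X in F) X = set0) ?setU0//.
    by rewrite -subset0 => t [G FG]; case: F0; exists G.
  rewrite /= (_ : _ `|` _ = \bigcup_(H in [set G0 `|` G | G in F]) H).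
    apply: sq_graph_bigcup => [_ [G FG <-]|_ _ [G FG <-] [G' FG' <-]]; first exact: FP.
    by have [GG|GG] := totF _ _ FG FG'; [left|right]; exact: setUS.
  apply/seteqP; split=> t.
    move=> [t0|[G FG Gt]]; first by exists (G0 `|` G1); [exists G1|left].
    by exists (G0 `|` G); [exists G|right].
  by move=> [_ [G FG <-] [t0|Gt]]; [left|right; exists G].
rewrite /= in gG Gmax; set H := G0 `|` G in gG.
have G0H : G0 `<=` H by exact: subsetUl.
have {}Gmax H' : sq_graph H' -> H `<=` H' -> H' `<=` H.
  move=> gH' HH'; have [H'G|nH'G] := pselect (H' `<=` G).
    exact: subset_trans (@subsetUr _ _ _).
  case: (Gmax H'); first by split=> // t Gt; apply: HH'; right.
  by rewrite setUidr // => t t0; apply: HH'; left.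
have [Hfun Hinj Hdom Htot] := gG.
pose A := sq_dom H.
have /choice[g gP] : forall p : K * K, exists z, A p.1 -> A p.2 -> H (p.1, p.2, z).
  move=> [x y]; have [[Ax Ay]|nA] := pselect (A x /\ A y).
    by have [z Hz] := Htot _ _ Ax Ay; exists z.
  by exists k0 => /= Ax Ay; case: nA.
have gA x y : A x -> A y -> A (g (x, y)).
  by move=> Ax Ay; have [] := Hdom _ _ _ (gP (x, y) Ax Ay).
have gI x y x' y' : A x -> A y -> A x' -> A y' -> g (x, y) = g (x', y') -> x = x' /\ y = y'.
  move=> Ax Ay Ax' Ay' e; have := gP (x, y) Ax Ay; rewrite /= e => h.
  exact: Hinj h (gP (x', y') Ax' Ay').
have Au n : A (u n) by exists (u (pickle (n, n))); apply: G0H; exists n, n.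
have [hle|hle] := card_le_or (~` A) A.
  have [j jA jI] := card_leE k0 hle.
  (* [K] is the disjoint union of [A] and its complement; the tags [u 0] and [u 1] keep the two
     images apart inside [A]. *)
  pose phi x := if pselect (A x) then g (u 0%N, x) else g (u 1%N, j x).
  have phiA x : A (phi x) by rewrite /phi; case: pselect => Ax; apply: gA => //; exact: jA.
  have phiI x y : phi x = phi y -> x = y.
    rewrite /phi; case: pselect => Ax; case: pselect => Ay /gI.
    - by move=> [].
    - by move=> [||||/uI]//; exact: jA.
    - by move=> [||||/uI]//; exact: jA.
    - by move=> [||||_ /jI]; [|exact: jA| |exact: jA|apply].
  exists (fun p => g (phi p.1, phi p.2)) => -[x y] [x' y'] /= /gI[]// /phiI -> /phiI ->.
  by [].
(* Otherwise copy [A] disjointly as [h @` A]: the three new quarters of the square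
   of the union, told apart by [tag], embed into the copy. *)
have [h hA hI] := card_leE k0 hle.
pose C := A `|` h @` A.
(* [e] sends a point of [A] to itself and a point of the copy to its original. *)
have /choice[e eP] : forall x, exists a, C x -> A a /\ x = if pselect (A x) then a else h a.
  move=> x; have [[Ax|[a Aa <-]]|nC] := pselect (C x); last by exists k0.
    by exists x => _; split=> //; case: pselect.
  by exists a => _; split=> //; case: pselect => // Aha; case: (hA _ Aa Aha).
have eA x : C x -> A (e x) by move=> /eP[].
have hAC a : A a -> C (h a) by right; exists a.
pose tag x y := if pselect (A x) then u 0%N else if pselect (A y) then u 1%N else u 2%N.
have tagA x y : A (tag x y)
  by rewrite /tag; case: pselect => Ax /=; [|case: pselect => Ay /=]; exact: Au.
have egA x y : C x -> C y -> A (g (e x, e y)) by move=> /eA Ax /eA Ay; exact: gA.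
pose new x y := h (g (tag x y, g (e x, e y))).
pose H' := H `|` [set t | exists x y, [/\ C x, C y, ~ (A x /\ A y) & t = (x, y, new x y)]].
have nnewA x y : C x -> C y -> ~ A (new x y).
  by move=> Cx Cy; apply: hA; apply: gA => //; exact: egA.
have domH' x : sq_dom H' x <-> C x.
  split=> [[z [Hz|[x' [y' [Cx _ _ [-> _ _]]]]//]]|Cx]; first by left; exists z.
  have [[z Hz]|nA] := pselect (A x); first by exists z; left.
  by exists (new x x); right; exists x, x; split=> // -[].
have [] : ~ H' `<=` H.
  move=> H'H; have nA : ~ A (h (u 0%N)) by exact: hA.
  have Ch : C (h (u 0%N)) by exact: hAC.
  suff /Hdom[//] : H (h (u 0%N), h (u 0%N), new (h (u 0%N)) (h (u 0%N))).
  by apply: H'H; right; exists (h (u 0%N)), (h (u 0%N)); split=> // -[].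
apply: Gmax; last exact: subsetUl.
split=> [x y z z'|x y x' y' z|x y z|x y /domH' Cx /domH' Cy].
- move=> [Hz|[x1 [y1 [Cx Cy nA [ex1 ey1 ez1]]]]] [Hz'|[x2 [y2 [Cx' Cy' nA' [ex2 ey2 ez2]]]]].
  + exact: Hfun Hz Hz'.
  + by case: nA'; rewrite -ex2 -ey2; have [? ? _] := Hdom _ _ _ Hz.
  + by case: nA; rewrite -ex1 -ey1; have [? ? _] := Hdom _ _ _ Hz'.
  + by rewrite ez1 ez2 -ex1 -ex2 -ey1 -ey2.
- move=> [Hz|[x1 [y1 [Cx Cy nA [ex1 ey1 ez1]]]]] [Hz'|[x2 [y2 [Cx' Cy' nA' [ex2 ey2 ez2]]]]].
  + exact: Hinj Hz Hz'.
  + by have [_ _ Az] := Hdom _ _ _ Hz; case: (nnewA _ _ Cx' Cy'); rewrite -ez2.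
  + by have [_ _ Az] := Hdom _ _ _ Hz'; case: (nnewA _ _ Cx Cy); rewrite -ez1.
  have znew : new x1 y1 = new x2 y2 by rewrite -ez1.
  rewrite ex1 ey1 ex2 ey2.
  have [Ag1 Ag2] := (egA _ _ Cx Cy, egA _ _ Cx' Cy').
  have [tagE eE] := gI _ _ _ _ (tagA x1 y1) Ag1 (tagA x2 y2) Ag2
      (hI _ _ (gA _ _ (tagA x1 y1) Ag1) (gA _ _ (tagA x2 y2) Ag2) znew).
  have [ex ey] := gI _ _ _ _ (eA _ Cx) (eA _ Cy) (eA _ Cx') (eA _ Cy') eE.
  (* [e] forgets only whether a point lies in [A] or in the copy; equality of the tags restores
     this. *)
  have eI a b : C a -> C b -> (A a <-> A b) -> e a = e b -> a = b.
    move=> /eP[_ +] /eP[_ +] ab e_ab.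
    case: (pselect (A a)) => Aa; case: (pselect (A b)) => Ab /= aE bE; try by tauto.
      by rewrite aE bE.
    by rewrite aE bE e_ab.
  have [Ax Ay] : (A x1 <-> A x2) /\ (A y1 <-> A y2).
    move: tagE; rewrite /tag.
    by case: (pselect (A x1)) => ?; case: (pselect (A x2)) => ?;
       case: (pselect (A y1)) => ?; case: (pselect (A y2)) => ? /= /uI // _; tauto.
  by split; apply: eI.
- move=> [Hz|[x1 [y1 [Cx Cy nA [-> -> ->]]]]].
    by have [? ? ?] := Hdom _ _ _ Hz; split; apply/domH'; left.
  by split; apply/domH' => //; apply: hAC; apply: gA => //; exact: egA.
- have [[Ax Ay]|nA] := pselect (A x /\ A y).
    by have [z Hz] := Htot _ _ Ax Ay; exists z; left.
  by exists (new x y); right; exists x, y.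
Qed.
End InfiniteSquare.

Definition embeds (T U : Type) := exists f : T -> U, injective f.

Section Embeds.
Variable K : Type.
Hypothesis infK : infinite_set [set: K].

Lemma embeds_prod T U : embeds T K -> embeds U K -> embeds (T * U) K.
Proof.
move=> [f fI] [g gI]; have [p pI] := infinite_square infK.
by exists (fun x => p (f x.1, g x.2)) => -[x y] [x' y'] /= /pI[/fI -> /gI ->].
Qed.

Lemma embeds_count (T : countType) : embeds T K.
Proof.
move/infiniteP: infK => leK.
have /card_leP[f] := leK; pose k0 := set_val (f (SigSub (mem_set (I : [set: nat] 0%N)))).
have [u _ uI] := card_leE k0 leK.
by exists (u \o pickle) => x y /= /uI e; exact/(pcan_inj pickleK)/e.
Qed.

Lemma embeds_seq T : embeds T K -> embeds (seq T) K.
Proof.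
move=> [f fI]; have [p pI] := infinite_square infK.
have [u uI] := embeds_count nat.
(* A list is coded by iterated pairing, the first component telling empty lists from nonempty
   ones. *)
pose code := fix code (s : seq T) := if s is x :: s' then p (u 1%N, p (f x, code s'))
  else p (u 0%N, u 0%N).
exists code; elim=> [|x s ih] [|y t] //=.
- by move=> /pI[/uI].
- by move=> /pI[/uI].
- by move=> /pI[/pI[/fI -> /ih ->]].
Qed.

End Embeds.

(** * Continua *)

Section Continua.
Variable X : topologicalType.
Implicit Types A B C F G K O U V : set X.

(** Compactness as an induction principle: if [P K] failed, the sets [A] with [P] true of [K] minus
    [A] would form a proper filter, and local validity of [P] contradicts a cluster point of it in
    [K]. *)
Lemma compact_ind K (P : set X -> Prop) : compact K -> P set0 ->
  (forall A B, P A -> P B -> P (A `|` B)) ->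
  (forall A B, A `<=` B -> P B -> P A) ->
  (forall x, K x -> exists2 A, nbhs x A & P A) -> P K.
Proof.
move=> cK P0 PU PS Px; apply: contrapT => nPK.
pose F : set_system X := [set A | P (K `\` A)].
have FF : ProperFilter F.
  split; first by rewrite /F /= setD0.
  split=> [|A B FA FB|A B AB FA]; first by rewrite /F /= setDT.
    by rewrite /F /= setDIr; exact: PU.
  by apply: PS FA => x [Kx nBx]; split=> // /AB.
have [|x [Kx xF]] := cK F FF; first by rewrite /F /= setDv.
have [A xA PA] := Px x Kx.
have FA : F (~` A) by apply: PS PA => y [_ /contrapT].
by have [y []] := xF _ _ FA xA.
Qed.

Lemma compact_sep1 K x : hausdorff_space X -> compact K -> ~ K x ->
  exists2 U, open U & K `<=` U /\ nbhs x (~` U).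
Proof.
move=> hX cK nKx.
apply: (compact_ind (P := fun A => exists2 U, open U & A `<=` U /\ nbhs x (~` U)) cK) => //=.
- by exists set0; [exact: open0|split => //; rewrite setC0; exact: filterT].
- move=> A B [U oU [AU xU]] [V oV [BV xV]]; exists (U `|` V); first exact: openU.
  split; last by rewrite setCU; exact: filterI.
  by move=> y [Ay|By]; [left; exact: AU|right; exact: BV].
- move=> A B AB [U oU [BU xU]]; exists U => //; split=> //.
  exact: subset_trans BU.
move=> y Ky; have xy : x != y by apply/eqP => xy; rewrite xy in nKx.
move: hX; rewrite open_hausdorff => /(_ _ _ xy) [[A B]] /= [xA yB] [oA oB AB].
exists B; first by apply: open_nbhs_nbhs; split=> //; rewrite inE in yB.
exists B => //; split=> //.
apply: filterS (open_nbhs_nbhs (conj oA (set_mem xA))) => z Az Bz.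
by have : (A `&` B) z by []; move: AB => /eqP ->.
Qed.

Lemma compact_sep A B : hausdorff_space X -> compact A -> compact B ->
  A `&` B = set0 ->
  exists U V, [/\ open U, open V, A `<=` U, B `<=` V & U `&` V = set0].
Proof.
move=> hX cA cB AB0.
apply: (compact_ind (P := fun A' => exists U V,
    [/\ open U, open V, A' `<=` U, B `<=` V & U `&` V = set0]) cA) => /=.
- by exists set0, setT; split; rewrite ?set0I//; [exact: open0|exact: openT].
- move=> C D [U [V [oU oV CU BV UV]]] [U' [V' [oU' oV' DU' BV' UV']]].
  exists (U `|` U'), (V `&` V'); split; [exact: openU|exact: openI| | |].
  + by move=> x [Cx|Dx]; [left; exact: CU|right; exact: DU'].
  + by move=> x Bx; split; [exact: BV|exact: BV'].
  + rewrite -subset0 => x [[Ux|Ux] [Vx Vx']]; first by rewrite -UV.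
    by rewrite -UV'.
- move=> C D CD [U [V [oU oV DU BV UV]]]; exists U, V; split=> //.
  exact: subset_trans DU.
move=> x Ax; have nBx : ~ B x by move=> Bx; rewrite -[False]/(set0 x) -AB0.
have [V oV [BV xV]] := compact_sep1 hX cB nBx.
exists (~` V)°; first exact: nbhs_interior.
exists (~` V)°, V; split=> //; first exact: open_interior.
by rewrite -subset0 => y [/interior_subset].
Qed.

Definition directed I (D : set I) (f : I -> set X) :=
  D !=set0 /\ forall i j, D i -> D j ->
    exists2 k, D k & f k `<=` f i `&` f j.

(** Every point of the compact set [f i0] minus [O] is missed by some [f i], hence has a
    neighbourhood missed by it; directedness merges finitely many such indices. *)
Lemma directed_bigcap_open I (D : set I) (f : I -> set X) O :
  hausdorff_space X -> directed D f -> (forall i, D i -> compact (f i)) ->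
  open O -> \bigcap_(i in D) f i `<=` O -> exists2 i, D i & f i `<=` O.
Proof.
move=> hX [[i0 Di0] dir] cf oO fO.
have cK : compact (f i0 `&` ~` O).
  by apply: compact_closedI; [exact: cf|rewrite closedC].
have [] := compact_ind (P := fun A => exists2 i, D i & f i `&` A = set0) cK.
- by exists i0 => //; rewrite setI0.
- move=> A B [i Di iA] [j Dj jB]; have [k Dk kij] := dir _ _ Di Dj.
  exists k => //; rewrite -subset0 => x [/kij[fi fj]] [Ax|Bx].
    by rewrite -iA.
  by rewrite -jB.
- move=> A B AB [i Di iB]; exists i => //; rewrite -subset0 => x [fi /AB Bx].
  by rewrite -iB.
- move=> x [fx nOx].
  have : ~ (\bigcap_(i in D) f i) x by move/fO.
  move/existsNP=> [i /not_implyP[Di nfx]].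
  exists (~` f i); last by exists i => //; rewrite setICr.
  apply: open_nbhs_nbhs; split=> //; rewrite openC.
  exact: compact_closed (cf _ Di).
move=> i Di ifO; have [k Dk kij] := dir _ _ Di Di0.
exists k => // x /kij[fix_ fi0x]; apply: contrapT => nOx.
by rewrite -[False]/(set0 x) -ifO.
Qed.

Lemma directed_bigcap_nonempty I (D : set I) (f : I -> set X) :
  hausdorff_space X -> directed D f ->
  (forall i, D i -> compact (f i) /\ f i !=set0) -> \bigcap_(i in D) f i !=set0.
Proof.
move=> hX dir cf; apply/set0P/negP => /eqP f0.
have [|i Di] := directed_bigcap_open (O := set0) hX dir (fun i Di => (cf i Di).1) (@open0 _).
  by rewrite f0.
by have [_ [x fx] fi0] := cf i Di; exact: (fi0 x).
Qed.

Lemma connected_open_split K U V : connected K -> open U -> open V ->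
  K `<=` U `|` V -> U `&` V = set0 -> K `&` U !=set0 -> K `<=` U.
Proof.
move=> cK oU oV KUV UV KU.
suff <- : K `&` U = K by [].
apply: cK => //; first by exists U.
exists (~` V); first by rewrite closedC.
apply/seteqP; split=> x [Kx]; last by have [|] := KUV _ Kx.
by move=> Ux; split=> // Vx; rewrite -[False]/(set0 x) -UV.
Qed.

(** The two separated pieces are closed in [K], hence compact, so they have disjoint open
    neighbourhoods in the ambient space. Unlike the pieces, these neighbourhoods still make sense on
    larger sets. *)
Lemma compact_not_connected K : hausdorff_space X -> compact K -> ~ connected K ->
  exists U V, [/\ open U, open V, K `<=` U `|` V, U `&` V = set0
    & K `&` U !=set0 /\ K `&` V !=set0].
Proof.
move=> hX cK /connectedPn[E [E0 KE [s1 s2]]].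
have cE b : compact (E b).
  have clK := compact_closed hX cK.
  have bK : closure (E b) `<=` K.
    rewrite [X in _ `<=` X](iffLR (closure_id _) clK); apply: closure_subset.
    by rewrite KE => x; case: b; [right|left].
  suff -> : E b = closure (E b).
    by apply: (subclosed_compact (B := K)) => //; exact: closed_closure.
  apply/seteqP; split; first exact: subset_closure.
  move=> x cx; have := bK _ cx; rewrite KE; case: b cx {bK} => cx [] // Ex.
    by have : (E false `&` closure (E true)) x by []; rewrite s2.
  by have : (closure (E false) `&` E true) x by []; rewrite s1.
have E01 : E false `&` E true = set0.
  by rewrite -subset0 => x [Ex Ey]; rewrite -s1; split=> //; exact: subset_closure.
have [U [V [oU oV EU EV UV]]] := compact_sep hX (cE false) (cE true) E01.
exists U, V; split=> //; first by rewrite KE; exact: setUSS.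
have [[x Ex] [y Ey]] := (E0 false, E0 true); split.
  by exists x; rewrite KE; split; [left|exact: EU].
by exists y; rewrite KE; split; [right|exact: EV].
Qed.

(** Open sets separating the intersection already cover one of the connected members, which must
    then lie in a single one of them. *)
Lemma directed_bigcap_subcontinuum I (D : set I) (f : I -> set X) :
  hausdorff_space X -> directed D f -> (forall i, D i -> subcontinuum (f i)) ->
  subcontinuum (\bigcap_(i in D) f i).
Proof.
move=> hX dir sf; have cf i : D i -> compact (f i) by move=> /sf[].
have cK : compact (\bigcap_(i in D) f i).
  have [[i Di] _] := dir; apply: (subclosed_compact (B := f i)) (cf _ Di) _.
    by apply: closed_bigI => j Dj; exact: compact_closed (cf _ Dj).
  by move=> x /(_ i Di).
split=> //; first by apply: directed_bigcap_nonempty => // i Di; have [] := sf i Di.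
apply: contrapT => /(compact_not_connected hX cK).
move=> [U [V [oU oV KUV UV [[x [Kx Ux]] [y [Ky Vy]]]]]].
have [i Di fUV] := directed_bigcap_open hX dir cf (openU oU oV) KUV.
have [_ _ conn] := sf i Di.
have /(_ y (Ky i Di)) Uy : f i `<=` U.
  by apply: connected_open_split oV fUV UV _ => //; exists x; split=> //; exact: Kx.
by rewrite -[False]/(set0 y) -UV.
Qed.

(* Boundary bumping: components and quasi-components of compacta coincide. *)
Lemma subcontinuum_between C F : hausdorff_space X -> subcontinuum C ->
  subcontinuum F -> F `<=` C -> F <> C ->
  exists2 C', subcontinuum C' & [/\ F `<=` C', C' `<=` C, C' <> F & C' <> C].
Proof.
move=> hX [C0 cC conC] [F0 cF conF] FC neFC.
have [x [Cx nFx]] : (C `\` F) !=set0.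
  by apply/set0P/negP => /eqP; rewrite setD_eq0 => CF; apply: neFC; exact/seteqP.
have Fx : F `&` [set x] = set0 by rewrite -subset0 => y [Fy yx]; rewrite yx in Fy.
have [U [V [oU oV FU xV UV]]] := compact_sep hX cF (@compact_set1 _ x) Fx.
pose G := C `&` ~` V.
have cG : compact G by apply: compact_closedI => //; rewrite closedC.
(* [D] consists of the clopen subsets of [G] containing [F]; their intersection [Q] is the
   quasi-component of [F] in [G]. *)
pose D := [set A | [/\ compact A, F `<=` A & exists2 W1, open W1 & A = G `&` W1]].
have FG : F `<=` G.
  move=> y Fy; split; first exact: FC.
  by move=> Vy; rewrite -[False]/(set0 y) -UV; split=> //; exact: FU.
have dir : directed D id.
  split; first by exists G; split=> //; exists setT; [exact: openT|rewrite setIT].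
  move=> A B -[cA FA [W1 oW1 AO1]] [cB FB [W2 oW2 BO2]]; exists (A `&` B) => //.
  split; [|by move=> y Fy; split; [exact: FA|exact: FB]|].
    by apply: compact_closedI => //; exact: compact_closed.
  by exists (W1 `&` W2); [exact: openI|rewrite AO1 BO2 setIACA setIid].
have cD A : D A -> compact A by case.
set Q := \bigcap_(A in D) id A.
have FQ : F `<=` Q by move=> y Fy A [_ FA _]; exact: FA.
have QG : Q `<=` G.
  by move=> y /(_ G); apply; split=> //; exists setT; [exact: openT|rewrite setIT].
have cQ : compact Q.
  apply: (subclosed_compact (B := G)) => //.
  by apply: closed_bigI => A DA; exact: compact_closed (cD _ DA).
(* A splitting of [Q] already splits some member [A] of [D]; the half containing [F] is again clopen
   in [G], so it belongs to [D] and excludes the other half from [Q]. *)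
have split2 W1 W2 : open W1 -> open W2 -> Q `<=` W1 `|` W2 -> W1 `&` W2 = set0 ->
    F `<=` W1 -> Q `&` W2 = set0.
  move=> oW1 oW2 QOO OO FO; have [A DA AOO] := directed_bigcap_open hX dir cD (openU oW1 oW2) QOO.
  have AOE : A `&` W1 = A `&` ~` W2.
    apply/seteqP; split=> y [Ay]; last by have [|] := AOO _ Ay.
    by move=> Oy; split=> // W2y; rewrite -[False]/(set0 y) -OO.
  have DAO : D (A `&` W1).
    have [cA FA [W oW AW]] := DA; split.
    - by rewrite AOE; apply: compact_closedI => //; rewrite closedC.
    - by move=> y Fy; split; [exact: FA|exact: FO].
    - by exists (W `&` W1); [exact: openI|rewrite AW setIA].
  by rewrite -subset0 => y [Qy W2y]; have [_ Oy] := Qy _ DAO; rewrite -OO.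
have conQ : connected Q.
  apply: contrapT => /(compact_not_connected hX cQ).
  move=> [W1 [W2 [oW1 oW2 QOO OO [[y [Qy Oy]] [z [Qz Oz]]]]]].
  have [w Fw] := F0.
  have [Ow|Ow] := QOO _ (FQ _ Fw).
    have FO : F `<=` W1.
      by apply: (connected_open_split conF oW1 oW2) => //; [exact: subset_trans QOO|exists w].
    by rewrite -[False]/(set0 z) -(split2 W1 W2).
  have FO : F `<=` W2.
    apply: (connected_open_split conF oW2 oW1); [|by rewrite setIC|by exists w].
    by rewrite setUC; exact: subset_trans QOO.
  by rewrite -[False]/(set0 y) -(split2 W2 W1) // ?[W2 `|` W1]setUC // [W2 `&` W1]setIC.
exists Q; first by split=> //; have [w /FQ Qw] := F0; exists w.
split=> //; first by move=> y /QG[].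
(* If [Q] were [F], some member [A] of [D] would lie in [U]. Away from [V] the sets [G] and [C]
   agree, so [A] would be clopen in [C], hence all of [C], although it misses [x]. *)
- move=> QF; have [|A DA AU] := directed_bigcap_open hX dir cD oU; first by rewrite -/Q QF.
  have [cA FA [W oW AW]] := DA.
  have AC : A = C.
    have [w /FA Aw] := F0; apply: conC; first by exists w.
    - exists (W `&` U); first exact: openI.
      apply/seteqP; split=> y; first by move=> Ay; move: (Ay) (AU _ Ay); rewrite {1}AW => -[[]].
      move=> [Cy [Wy Uy]]; rewrite AW; split=> //; split=> // Vy.
      by rewrite -[False]/(set0 y) -UV.
    - exists A; first exact: compact_closed.
      by rewrite setIC; apply/esym/setIidPl; rewrite AW => y [[]].
  by have : A x by [rewrite AC]; rewrite AW => -[[_ nVx] _]; exact/nVx/xV.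
- by move=> QC; have := Cx; rewrite -QC => /QG[_ nVx]; exact/nVx/xV.
Qed.

End Continua.

Lemma continuous_pair (X Y Z : topologicalType) (f : X -> Y) (g : X -> Z) :
  continuous f -> continuous g -> continuous (fun x => (f x, g x)).
Proof.
move=> cf cg x; apply: (@cvg_pair _ _ _ _ (nbhs (f x)) (nbhs (g x))).
  exact: cf.
exact: cg.
Qed.

Lemma compact_image (X Y : topologicalType) (f : X -> Y) (K : set X) :
  continuous f -> compact K -> compact (f @` K).
Proof. by move=> cf; apply: continuous_compact; exact: continuous_subspaceT. Qed.

Lemma connected_image (X Y : topologicalType) (f : X -> Y) (K : set X) :
  continuous f -> connected K -> connected (f @` K).
Proof.
move=> cf cK; apply: connected_continuous_connected cK _.
exact: continuous_subspaceT.
Qed.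

Lemma subcontinuum_image (X Y : topologicalType) (f : X -> Y) (K : set X) :
  continuous f -> subcontinuum K -> subcontinuum (f @` K).
Proof.
move=> cf [[x Kx] cK conK]; split; first by exists (f x), x.
- exact: compact_image.
- exact: connected_image.
Qed.

Lemma closed_fun_eq (X Y : topologicalType) (f g : X -> Y) :
  hausdorff_space Y -> continuous f -> continuous g ->
  closed [set x | f x = g x].
Proof.
move=> hY cf cg x clx; apply: hY => A B fA gB.
have := clx _ (filterI (cf x A fA : nbhs x (f @^-1` A)) (cg x B gB : nbhs x (g @^-1` B))).
by case=> y [/= <- [Ay By]]; exists (f y).
Qed.

Lemma hausdorff_prod (X Y : topologicalType) :
  hausdorff_space X -> hausdorff_space Y -> hausdorff_space (X * Y)%type.
Proof.
move=> hX hY [x y] [x' y'] cl; congr pair.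
  apply: hX => A B xA xB.
  have [|[a b] [/= Aa Ba]] := cl (fst @^-1` A) (fst @^-1` B) (cvg_fst xA).
    exact: cvg_fst.
  by exists a.
apply: hY => A B xA xB.
have [|[a b] [/= Aa Ba]] := cl (snd @^-1` A) (snd @^-1` B) (cvg_snd xA).
  exact: cvg_snd.
by exists b.
Qed.


(** Zorn's lemma for reverse inclusion: a nonempty chain is a directed family, whose intersection is
    the required bound. *)
Lemma minimal_subcontinuum (X : topologicalType) (P : set X -> Prop) (L : set X) :
  hausdorff_space X -> P L ->
  (forall (D : set (set X)), directed D id -> D `<=` P -> P (\bigcap_(A in D) A)) ->
  exists C, [/\ P C, C `<=` L & forall C', C' `<=` C -> P C' -> C' = C].
Proof.
move=> hX PL PD.
pose T := {A : set X | P A /\ A `<=` L}.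
pose Rl (A B : T) := `[< sval B `<=` sval A >].
have [| | | |C Cmin] := @Zorn T Rl.
- by move=> A; apply/asboolP.
- by move=> A B C /asboolP AB /asboolP BC; apply/asboolP; exact: subset_trans AB.
- by move=> [A PA] [B PB] /asboolP AB /asboolP BA; exact/eq_exist/seteqP.
- move=> S totS; have [[A0 SA0]|S0] := pselect (S !=set0); last first.
    by exists (exist _ L (conj PL (@subset_refl _ L))) => A SA; case: S0; exists A.
  pose D := [set sval A | A in S].
  have dir : directed D id.
    split; first by exists (sval A0), A0.
    move=> _ _ [A SA <-] [B SB <-]; have [|] := totS _ _ SA SB => /asboolP AB.
      by exists (sval B); [exists B|rewrite subsetI; split].
    by exists (sval A); [exists A|rewrite subsetI; split].
  have PK : P (\bigcap_(A in D) A) by apply: PD => // _ [[A [PA AL]] _ <-].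
  have KL : \bigcap_(A in D) A `<=` L.
    by move=> x /(_ (sval A0)) Kx; apply: (svalP A0).2; apply: Kx; exists A0.
  exists (exist _ (\bigcap_(A in D) A) (conj PK KL) : T) => A SA.
  apply/asboolP => x /(_ (sval A)); apply.
  by exists A.
exists (sval C); have [PC CL] := svalP C; split=> // C' C'C PC'.
have C'L := subset_trans C'C CL.
have := Cmin (exist _ C' (conj PC' C'L) : T).
by case: C {Cmin PC CL} C'C => C hC /= C'C h; apply: (congr1 sval (h _)); apply/asboolP.
Qed.


(** * Hereditarily indecomposable continua and integral coverings *)

Section Covering.
Variables (R : realType) (Y : topologicalType).
Local Notation E := (Y * R)%type.
Hypotheses (hY : hausdorff_space Y) (hiY : hereditarily_indecomposable Y).
Implicit Types A B C D F K L : set E.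

(* [Et] plays the role of a covering space of [Y] with group Z, embedded in
   [Y * R] so that the deck transformations are integer translations. *)
Variable Et : set E.
Hypothesis Et_fiber : forall a b, Et a -> Et b -> a.1 = b.1 ->
  exists k : int, a.2 - b.2 = k%:~R.
Hypothesis Et_shift : forall a (k : int), Et a -> Et (a.1, a.2 + k%:~R).

Let hE : hausdorff_space E.
Proof. by apply: hausdorff_prod => //; exact: Rhausdorff. Qed.

Let c1 : continuous (fst : E -> Y). Proof. by move=> x; exact: cvg_fst. Qed.
Let c2 : continuous (snd : E -> R). Proof. by move=> x; exact: cvg_snd. Qed.

(** Distinct points of a fibre of [Et] differ by a nonzero integer. Stating this as distance at
    least 1 makes it a closed condition, so that failure of injectivity is witnessed by a compact
    set. *)
Definition fiber_pairs A B : set (E * E) :=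
  [set p | [/\ A p.1, B p.2, p.1.1 = p.2.1 & 1 <= `|p.1.2 - p.2.2|]].

Lemma fiber_pairs_compact A B : compact A -> compact B -> compact (fiber_pairs A B).
Proof.
move=> cA cB; apply: (subclosed_compact (B := A `*` B)); last by move=> p [].
  have clA := compact_closed hE cA; have clB := compact_closed hE cB.
  rewrite (_ : fiber_pairs A B = (fst @^-1` A `&` snd @^-1` B) `&`
      ([set p : E * E | p.1.1 = p.2.1] `&`
       (fun p : E * E => `|p.1.2 - p.2.2|) @^-1` [set x | 1 <= x])); last first.
    by apply/seteqP; split=> p; [case|case=> -[? ?] []].
  have f1 : continuous (fst : E * E -> E) by move=> x; exact: cvg_fst.
  have f2 : continuous (snd : E * E -> E) by move=> x; exact: cvg_snd.
  apply: closedI; apply: closedI.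
  - exact: ((continuous_closedP _).1 f1).
  - exact: ((continuous_closedP _).1 f2).
  - apply: closed_fun_eq => // x.
      by apply: (@continuous_comp _ _ _ fst fst); [exact: f1|exact: c1].
    by apply: (@continuous_comp _ _ _ snd fst); [exact: f2|exact: c1].
  - apply: (continuous_closedP _).1 (@closed_ge R 1) => x.
    apply: cvg_norm; apply: cvgB.
      by apply: (@continuous_comp _ _ _ fst snd); [exact: f1|exact: c2].
    by apply: (@continuous_comp _ _ _ snd snd); [exact: f2|exact: c2].
exact: compact_setX.
Qed.

Definition inj_fst A := forall a b, A a -> A b -> a.1 = b.1 -> a = b.

Lemma fiber_dist a b : Et a -> Et b -> a.1 = b.1 -> a <> b -> 1 <= `|a.2 - b.2|.
Proof.
move=> Ea Eb ab nab; have [k abk] := Et_fiber Ea Eb ab.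
rewrite abk; apply: norm_intr_ge1; first exact: intr_int.
rewrite intr_eq0; apply: contra_notN nab => /eqP k0.
move: a b ab abk {Ea Eb} => [y s] [z t] /= -> /eqP.
by rewrite k0 subr_eq0 => /eqP ->.
Qed.

Lemma fiber_pairs_eq0 A : A `<=` Et -> (inj_fst A <-> fiber_pairs A A = set0).
Proof.
move=> AE; split=> [iA|A0 a b Aa Ab ab].
  rewrite -subset0 => -[a b] [/= Aa Ab ab]; rewrite (iA _ _ Aa Ab ab) subrr normr0.
  by rewrite lt_geF.
apply: contrapT => nab; have : fiber_pairs A A (a, b).
  by split=> //=; apply: fiber_dist => //; exact: AE.
by rewrite A0.
Qed.

(* Over [fst @` D] the covering is a disjoint union of translates of [D]. *)
Lemma sheet_absorbs C D : compact C -> connected C -> compact D -> C `<=` Et -> D `<=` Et ->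
  inj_fst D -> fst @` C `<=` fst @` D -> C `&` D !=set0 -> C `<=` D.
Proof.
move=> cC conC cD CE DE iD CD CD0.
(* [N] collects the points of [C] lying over a point of [D] on another sheet. It is compact and
   disjoint from the intersection of [C] and [D], and the two together exhaust the connected set
   [C]. *)
pose N := fst @` fiber_pairs C D.
have cN : compact N by apply: compact_image; [move=> x; exact: cvg_fst|exact: fiber_pairs_compact].
have cCD : compact (C `&` D) by apply: compact_closedI => //; exact: compact_closed.
have CDN : C `&` D `&` N = set0.
  rewrite -subset0 => a [[Ca Da] [[x b] [/= _ Db xb x1] /= xa]].
  move: xb x1; rewrite xa => ab; rewrite (iD _ _ Da Db ab) subrr normr0.
  by rewrite lt_geF.
have [U [V [oU oV CU NV UV]]] := compact_sep hE cCD cN CDN.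
have CDorN a : C a -> D a \/ N a.
  move=> Ca; have [Da|nDa] := pselect (D a); [by left|right].
  have [b Db ba] : (fst @` D) a.1 by apply: CD; exists a.
  exists (a, b) => //; split=> //=; apply: fiber_dist => //; [exact: CE|exact: DE|].
  by move=> ab; rewrite ab in nDa.
have CUV : C `<=` U `|` V.
  by move=> a Ca; have [Da|/NV] := CDorN a Ca; [left; exact: CU|right].
have CsubU : C `<=` U.
  apply: connected_open_split oV CUV UV _ => //.
  by have [a [Ca Da]] := CD0; exists a; split=> //; exact: CU.
move=> a Ca; have [//|/NV Va] := CDorN a Ca.
by have : (U `&` V) a by [split=> //; exact: CsubU]; rewrite UV.
Qed.

(** The projections overlap, so their union is a subcontinuum of [Y] and by hereditary
    indecomposability one contains the other; [sheet_absorbs] lifts this inclusion. *)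
Lemma subcontinua_nested C D : subcontinuum C -> subcontinuum D -> C `<=` Et -> D `<=` Et ->
  inj_fst C -> inj_fst D -> C `&` D !=set0 -> C `<=` D \/ D `<=` C.
Proof.
move=> sC sD CE DE iC iD CD0.
have [C0 cC conC] := sC; have [D0 cD conD] := sD.
have pC := subcontinuum_image c1 sC; have pD := subcontinuum_image c1 sD.
have sU : subcontinuum (fst @` C `|` fst @` D).
  have [[x Cx] ? ?] := pC; have [_ ? ?] := pD; split; first by exists x; left.
    exact: compactU.
  apply: connectedU => //; have [a [Ca Da]] := CD0.
  by exists a.1; split; exists a.
have [h|h] := hiY sU pC pD erefl.
  right; apply: sheet_absorbs => //; last by rewrite setIC.
  by rewrite h; right.
by left; apply: sheet_absorbs => //; rewrite h; left.
Qed.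

Definition shift (k : int) (a : E) : E := (a.1, a.2 + k%:~R).

Lemma shift_continuous k : continuous (shift k).
Proof.
apply: continuous_pair => a; first exact: cvg_fst.
by apply: cvgD; [exact: cvg_snd|exact: cvg_cst].
Qed.

(** Iterating a nonzero integer shift would make the real coordinate unbounded on a compact set. *)
Lemma shift_sub_eq0 C k : compact C -> C !=set0 -> shift k @` C `<=` C -> k = 0.
Proof.
move=> cC [a Ca] kC; apply/eqP/negPn/negP => k0.
have /compact_bounded[M [_ MC]] := compact_image c2 cC.
have {}MC b : C b -> `|b.2| <= M + 1.
  by move=> Cb; apply: (MC (M + 1)); [rewrite ltrDl|exists b].
have Cn n : C (a.1, a.2 + k%:~R *+ n).
  elim: n => [|n ih]; first by rewrite mulr0n addr0 -surjective_pairing.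
  by rewrite mulrSr addrA; apply: kC; exists (a.1, a.2 + k%:~R *+ n).
have k1 : 1 <= `|k%:~R : R| by apply: norm_intr_ge1; [exact: intr_int|rewrite intr_eq0].
have bound n : n%:R <= (M + 1) + (M + 1).
  have -> : n%:R = 1 *+ n :> R by [].
  rewrite (le_trans (ler_wMn2r n k1))// -normrMn.
  have -> : k%:~R *+ n = (a.2 + k%:~R *+ n) - a.2 by rewrite addrAC subrr add0r.
  by rewrite (le_trans (ler_normB _ _))// lerD//; [exact: MC (Cn n)|exact: MC].
have [n _ /(_ n (leqnn _)) /= nM] := @nbhs_infty_gtr R (M + 1 + (M + 1)).
by have := bound n; rewrite leNgt nM.
Qed.

(* Let [C] be a minimal subcontinuum that is not injective over [Y]. It meets some
   translate [D = C + k], and the component [F] of [C `&` D] is proper in both; a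
   continuum strictly between [F] and [C] and one strictly between [F] and [D] are
   injective over [Y], hence nested, so one of them lies in [C `&` D]. *)
Lemma subcontinuum_inj_fst L : subcontinuum L -> L `<=` Et -> inj_fst L.
Proof.
move=> sL LE; apply: contrapT => nL.
(* Noninjectivity is stated as nonemptiness of the compact set of fibre pairs, because this passes
   to directed intersections. *)
pose P A := [/\ subcontinuum A, A `<=` Et & fiber_pairs A A !=set0].
have PL : P L.
  split=> //; apply/set0P/negP => /eqP; exact/(fiber_pairs_eq0 LE).
have [D dir DP|C [[sC CE C2] _ Cmin]] := minimal_subcontinuum hE PL.
  have [[A0 DA0] dirD] := dir; split.
  - by apply: directed_bigcap_subcontinuum => // A /DP[].
  - by move=> a /(_ A0 DA0); have [_ A0E _] := DP _ DA0; exact: A0E.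
  have [||p pP] := directed_bigcap_nonempty (D := D) (f := fun A => fiber_pairs A A)
      (hausdorff_prod hE hE).
  - split; first by exists A0.
    move=> A B DA DB; have [K DK KAB] := dirD _ _ DA DB.
    by exists K => // p [/KAB[? ?] /KAB[? ?] ? ?]; split; split.
  - by move=> A /DP[[_ cA _] _ A2]; split=> //; exact: fiber_pairs_compact.
  exists p; have [_ _ p1 p2] := pP _ DA0; split=> // A DA; by have [] := pP _ DA.
have properC A : subcontinuum A -> A `<=` C -> A <> C -> inj_fst A.
  move=> sA AC nAC; have AE := subset_trans AC CE.
  apply/(fiber_pairs_eq0 AE)/eqP/negPn/negP => /set0P A2.
  by apply: nAC; apply: Cmin => //; split.
have [[a b] /= [/= Ca Cb ab ab1]] := C2.
have [k abk] := Et_fiber (CE _ Ca) (CE _ Cb) ab.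
have k0 : k != 0.
  by apply: contraTneq ab1 => k0; rewrite abk k0 normr0 lt_geF.
pose D := shift k @` C.
have sD : subcontinuum D by apply: subcontinuum_image => //; exact: shift_continuous.
have DE : D `<=` Et by move=> _ [c Cc <-]; exact/Et_shift/CE.
have Da : D a.
  by exists b => //; rewrite /shift -abk addrC subrK -ab -surjective_pairing.
have shiftK c : shift (- k) (shift k c) = c.
  by rewrite /shift /= rmorphN /= addrK -surjective_pairing.
have shiftNK c : shift k (shift (- k) c) = c.
  by rewrite /shift /= rmorphN /= subrK -surjective_pairing.
have properD A : subcontinuum A -> A `<=` D -> A <> D -> inj_fst A.
  move=> sA AD nAD.
  have iA' : inj_fst (shift (- k) @` A).
    apply: properC.
    - by apply: subcontinuum_image => //; exact: shift_continuous.
    - by move=> _ [c /AD [d Cd <-] <-]; rewrite shiftK.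
    - move=> AeqC; apply: nAD; rewrite /D -AeqC; apply/seteqP; split=> c.
        by move=> Ac; exists (shift (- k) c) => //; exists c.
      by move=> [_ [d Ad <-] <-]; rewrite shiftNK.
  move=> c d Ac Ad cd; rewrite -[c]shiftNK -[d]shiftNK; congr shift.
  by apply: iA'; [exists c|exists d|].
have [C0 cC conC] := sC; have [D0 cD conD] := sD.
pose F := connected_component (C `&` D) a.
have FCD : F `<=` C `&` D by exact: connected_component_sub.
have sF : subcontinuum F.
  split; first by exists a; exact: connected_component_refl.
    apply: (subclosed_compact (B := C)) => //; last by move=> c /FCD[].
    by apply: component_closed; apply: closedI; exact: compact_closed.
  exact: component_connected.
(* If [F] were [C], then [C] would lie in its translate [D], and shifting by [- k] would map [C]
   into itself. *)
have FnC : F <> C.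
  move=> FC; suff : - k = 0 by apply/eqP; rewrite oppr_eq0.
  apply: (shift_sub_eq0 cC C0) => _ [c Cc <-].
  have : F c by rewrite FC.
  by move=> /FCD[_ [d Cd <-]]; rewrite shiftK.
have FnD : F <> D.
  move=> FD; suff : k = 0 by exact/eqP.
  apply: (shift_sub_eq0 cC C0) => _ [c Cc <-].
  have : F (shift k c) by rewrite FD; exists c.
  by move=> /FCD[].
have [|C' sC' [FC' C'C C'F C'nC]] := subcontinuum_between hE sC sF _ FnC.
  by move=> c /FCD[].
have [|D' sD' [FD' D'D D'F D'nD]] := subcontinuum_between hE sD sF _ FnD.
  by move=> c /FCD[].
have Fa : F a by exact: connected_component_refl.
have maxF A : subcontinuum A -> F `<=` A -> A `<=` C `&` D -> A = F.
  move=> [_ _ conA] FA ACD; apply/seteqP; split=> //.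
  by apply: connected_component_max => //; exact: FA.
have [CD|DC] : C' `<=` D' \/ D' `<=` C'.
- apply: subcontinua_nested => //.
  + exact: subset_trans CE.
  + exact: subset_trans DE.
  + exact: properC.
  + exact: properD.
  + by exists a; split; [exact: FC'|exact: FD'].
- apply: C'F; apply: maxF => // c Cc; split; first exact: C'C.
  exact/D'D/CD.
- apply: D'F; apply: maxF => // c Dc; split; last exact: D'D.
  exact/C'C/DC.
Qed.

End Covering.

(** * First Cech cohomology *)

Section RealCobounding.
Variables (R : realType) (Y : topologicalType).
Hypotheses (hY : hausdorff_space Y) (cY : compact [set: Y]).

Lemma bump_function (y : Y) (v : set Y) : open v -> v y ->
  exists2 g : Y -> R, continuous g &
    [/\ forall x, 0 <= g x, g y = 1 & forall x, ~ v x -> g x = 0].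
Proof.
move=> ov vy.
have sep : @uniform_separator Y [set y] (~` v).
  apply: (@normal_completely_regular R) => //.
  - exact: compact_normal.
  - exact: hausdorff_accessible.
  - by rewrite closedC.
pose u := @Urysohn Y R [set y] (~` v).
have uc : continuous u by exact: Urysohn_continuous.
exists (fun x => 1 - u x).
  by move=> x; apply: cvgB; [exact: cvg_cst|exact: uc].
split=> [x||x nvx].
- have := @Urysohn_range Y R [set y] (~` v) (u x); rewrite subr_ge0 => h.
  have /h /= : range u (u x) by exists x.
  by rewrite in_itv /= => /andP[].
- by rewrite (@Urysohn_sub0 _ R _ _ sep (u y)) ?subr0//; exists y.
- by rewrite (@Urysohn_sub1 _ R _ _ sep (u x)) ?subrr//; exists x.
Qed.

(* The sheaf of real functions is acyclic; here through a partition of unity. *)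
Lemma real_cobounding (U : set (set Y)) (c : set Y -> set Y -> int) :
  open_covering U -> cocycle U c ->
  exists2 h : set Y -> Y -> R, forall u, continuous (h u) &
    forall u v y, U u -> U v -> u y -> v y -> h u y - h v y = (c u v)%:~R.
Proof.
move=> [oU UY] cocy.
(* The cobounding identity is carried with a weight [g], which makes it additive over finite covers;
   dividing by the positive total weight at the end replaces the normalisation of the partition of
   unity. *)
have [g [h [gc g0 gpos hc hE]]] : exists (g : Y -> R) (h : set Y -> Y -> R),
    [/\ continuous g, forall x, 0 <= g x, forall x, [set: Y] x -> 0 < g x,
      forall u, continuous (h u)
    & forall u v y, U u -> U v -> u y -> v y -> h u y - h v y = g y * (c u v)%:~R].
  apply: (compact_ind (P := fun A => exists (g : Y -> R) (h : set Y -> Y -> R),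
    [/\ continuous g, forall x, 0 <= g x, forall x, A x -> 0 < g x,
      forall u, continuous (h u)
    & forall u v y, U u -> U v -> u y -> v y -> h u y - h v y = g y * (c u v)%:~R]) cY).
  - exists (cst 0), (fun=> cst 0); split=> //.
    + by move=> x; exact: cvg_cst.
    + by move=> u x; exact: cvg_cst.
    + by move=> *; rewrite /cst mul0r subrr.
  - move=> A B [g [h [gc g0 gpos hc hE]]] [g' [h' [gc' g0' gpos' hc' hE']]].
    exists (fun x => g x + g' x), (fun u x => h u x + h' u x); split.
    + by move=> x; apply: cvgD; [exact: gc|exact: gc'].
    + by move=> x; exact: addr_ge0.
    + move=> x [/gpos|/gpos'] gx; first by rewrite ltr_wpDr.
      by rewrite ltr_wpDl.
    + by move=> u x; apply: cvgD; [exact: hc|exact: hc'].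
    + by move=> u v y Uu Uv uy vy; rewrite opprD addrACA hE// hE'// mulrDl.
  - move=> A B AB [g [h [gc g0 gpos hc hE]]]; exists g, h; split=> //.
    by move=> x /AB; exact: gpos.
  - move=> y _; have [v Uv vy] : (\bigcup_(u in U) u) y by rewrite UY.
    have [g gc [g0 gy gv]] := bump_function (oU _ Uv) vy.
    exists (g @^-1` [set x | 0 < x]).
      apply: gc; apply: open_nbhs_nbhs; split; first exact: open_gt.
      by rewrite /= gy.
    (* Where [g] is nonzero the point lies in [v], so the values [c u v] cobound [c] there by the
       cocycle identity; elsewhere both sides vanish. *)
    exists g, (fun u x => g x * (c u v)%:~R); split=> //.
      by move=> u x; apply: cvgM; [exact: gc|exact: cvg_cst].
    move=> u w x Uu Uw ux wx; rewrite -mulrBr.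
    have [vx|nvx] := pselect (v x); last by rewrite gv ?mul0r.
    rewrite -(cocy u w v) //; last by exists x; split.
    by rewrite rmorphD /= addrK.
exists (fun u x => h u x / g x).
  move=> u x; apply: cvgM; first exact: hc.
  by apply: cvgV; [rewrite gt_eqF//; exact: gpos|exact: gc].
move=> u v y Uu Uv uy vy; rewrite -mulrBl hE// mulrAC divff ?mul1r//.
by rewrite gt_eqF//; exact: gpos.
Qed.

End RealCobounding.

(** * Pullback of Cech cocycles along a continuous surjection *)

Section Pullback.
Variables (X Y : topologicalType) (f : X -> Y).
Hypotheses (fc : continuous f) (fsurj : forall y, exists x, f x = y).

Lemma image_preimageK (u : set Y) : f @` (f @^-1` u) = u.
Proof.
apply/seteqP; split=> y; first by move=> [x ux <-].
by have [x <-] := fsurj y => ux; exists x.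
Qed.

Definition preimage_cov (U : set (set Y)) : set (set X) := [set f @^-1` u | u in U].

Lemma preimage_covP U : open_covering U -> open_covering (preimage_cov U).
Proof.
move=> [oU UY]; split=> [_ [u Uu <-]|].
  by move/continuousP: fc; apply; exact: oU.
rewrite -subTset => x _; have [u Uu ux] : (\bigcup_(u in U) u) (f x) by rewrite UY.
by exists (f @^-1` u) => //; exists u.
Qed.

(** Since [f] is onto, the image of a preimage recovers the original member of the cover, so no
    choice of a member is involved. *)
Definition preimage_val (c : set Y -> set Y -> int) : set X -> set X -> int :=
  fun w w' => c (f @` w) (f @` w').

Lemma preimage_valP U c : cocycle U c -> cocycle (preimage_cov U) (preimage_val c).
Proof.
move=> cP _ _ _ [u Uu <-] [v Uv <-] [w Uw <-] [x [[ux vx] wx]].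
by rewrite /preimage_val !image_preimageK; apply: cP => //; exists (f x).
Qed.

Definition cech_pull (z : cech_cocycle Y) : cech_cocycle X :=
  CechCocycle (preimage_covP (cech_covP z)) (preimage_valP (@cech_valP _ z)).

Lemma refinement_map_pull W U r : refinement_map W U r ->
  refinement_map (preimage_cov W) (preimage_cov U) (fun w => f @^-1` r (f @` w)).
Proof.
move=> rP _ [w Ww <-]; rewrite image_preimageK; have [Ur wr] := rP _ Ww.
by split; [exists (r w)|move=> x /wr].
Qed.

Lemma cech_pull_equiv z z' : cech_equiv z z' -> cech_equiv (cech_pull z) (cech_pull z').
Proof.
move=> [W [r [r' [oW rP rP' [b bP]]]]].
exists (preimage_cov W), (fun w => f @^-1` r (f @` w)), (fun w => f @^-1` r' (f @` w)).
split; [exact: preimage_covP|exact: refinement_map_pull|exact: refinement_map_pull|].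
exists (fun w => b (f @` w)) => _ _ [u Wu <-] [v Wv <-] [x [ux vx]].
rewrite /pullback /= /preimage_val !image_preimageK; apply: bP => //.
by exists (f x).
Qed.

(** The refinement maps selected by [refmap] on [X] and on [Y] need not correspond to each other;
    [res_map] absorbs the discrepancy up to a coboundary. *)
Lemma cech_pull_add z z' :
  cech_equiv (cech_pull (cech_add z z')) (cech_add (cech_pull z) (cech_pull z')).
Proof.
have ml := refmapP (cov_refines_meetl (cech_cov z) (cech_cov z')).
have mr := refmapP (cov_refines_meetr (cech_cov z) (cech_cov z')).
apply: cech_equiv_common => W h k.
have hl : refinement_map (preimage_cov (cech_cov (cech_add z z'))) (preimage_cov (cech_cov z))
   (fun w => f @^-1` refmap (meet_cov (cech_cov z) (cech_cov z')) (cech_cov z) (f @` w)).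
  exact: refinement_map_pull.
have hr : refinement_map (preimage_cov (cech_cov (cech_add z z'))) (preimage_cov (cech_cov z'))
   (fun w => f @^-1` refmap (meet_cov (cech_cov z) (cech_cov z')) (cech_cov z') (f @` w)).
  exact: refinement_map_pull.
apply: coh_sym; apply: coh_trans (res_add k) _.
have hr1 : cov_refines (cech_cov (cech_pull (cech_add z z'))) (cech_cov (cech_pull z)).
  by eexists; exact: hl.
have hr2 : cov_refines (cech_cov (cech_pull (cech_add z z'))) (cech_cov (cech_pull z')).
  by eexists; exact: hr.
have key : cohomologous (cech_cov (cech_pull (cech_add z z')))
   (cech_val_add (cech_res (cech_cov (cech_pull (cech_add z z'))) (cech_pull z))
     (cech_res (cech_cov (cech_pull (cech_add z z'))) (cech_pull z')))
   (cech_val (cech_pull (cech_add z z'))).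
  apply: coh_trans (coh_add (@res_map _ _ (cech_pull z) _ hl) (@res_map _ _ (cech_pull z') _ hr)) _.
  by apply: coh_eq => u v; rewrite /cech_val_add /pullback /= /preimage_val /= !image_preimageK.
apply: coh_trans (coh_pull (refmapP h) key).
by apply: coh_add; exact: res_res.
Qed.

End Pullback.

(** * Injectivity of the pullback on first cohomology *)

Section Kernel.
Variables (R : realType) (X Y : topologicalType) (f : X -> Y).
Hypotheses (fc : continuous f) (fsurj : forall y, exists x, f x = y).
Hypotheses (contX : continuum X) (contY : continuum Y).
Hypothesis hiY : hereditarily_indecomposable Y.

Let hY : hausdorff_space Y. Proof. by case: contY. Qed.

(** A continuous surjection from a compact space to a Hausdorff one is closed, hence a quotient
    map. *)
Lemma quotient_continuous (Z : topologicalType) (s : Y -> Z) :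
  continuous (s \o f) -> continuous s.
Proof.
move=> cs; apply/continuous_closedP => A cA.
have -> : s @^-1` A = f @` ((s \o f) @^-1` A).
  apply/seteqP; split=> [y|_ [x Ax <-]//].
  by have [x <-] := fsurj y => Ax; exists x.
apply: compact_closed => //; apply: compact_image => //.
have [_ _ cX _] := contX.
by apply: (subclosed_compact _ cX) => //; exact: (continuous_closedP _).1.
Qed.

Lemma cech_pull_eq0 z : cech_equiv (cech_pull fc fsurj z) (cech_zero X) ->
  cech_equiv z (cech_zero Y).
Proof.
move=> [W [r [r0 [[oW WX] rP _ [b bP]]]]].
have cY : compact [set: Y] by case: contY.
have [oU UY] := cech_covP z; set U := cech_cov z in oU UY rP bP.
have [h hc hE] := real_cobounding R hY cY (cech_covP z) (@cech_valP _ z).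
rewrite -/U in hE.
pose uof w := f @` r w.
have uofP w : W w -> U (uof w) /\ forall x, w x -> uof w (f x).
  move=> Ww; have [[u Uu uE] wr] := rP _ Ww; rewrite /uof -uE image_preimageK //.
  by split=> // x /wr; rewrite -uE.
pose wof x := xget set0 [set w | W w /\ w x].
have wofP x : W (wof x) /\ wof x x.
  apply: (@xgetPex _ set0 [set w | W w /\ w x]).
  by have [w Ww wx] : (\bigcup_(w in W) w) x by [rewrite WX]; exists w.
(* The integers [b] cancel the jumps of [h]: every member of [W] around [x] yields the same value,
   which also makes [H] continuous. It is the real coordinate of the lift of [f]. *)
pose H x : R := h (uof (wof x)) (f x) - (b (wof x))%:~R.
have HE x w : W w -> w x -> H x = h (uof w) (f x) - (b w)%:~R.
  move=> Ww wx; have [Wx xx] := wofP x.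
  have [Uw uw] := uofP _ Ww; have [Ux ux] := uofP _ Wx.
  have bE := bP w (wof x) Ww Wx (ex_intro _ x (conj wx xx)).
  have := hE (uof w) (uof (wof x)) (f x) Uw Ux (uw _ wx) (ux _ xx).
  move: bE; rewrite /cech_val_zero /pullback /= sub0r /preimage_val -/(uof w) -/(uof (wof x)).
  move=> /(congr1 -%R); rewrite opprK opprB => ->; rewrite rmorphB /H /= => hb.
  lra.
have Hc : continuous H.
  move=> x; have [Wx xx] := wofP x.
  have nx : nbhs x (wof x) by apply: open_nbhs_nbhs; split=> //; exact: oW.
  rewrite /continuous_at (HE x _ Wx xx).
  apply: (@cvg_trans _ ((fun x' => h (uof (wof x)) (f x') - (b (wof x))%:~R) @ x)).
    apply: near_eq_cvg; apply: filterS nx => x' xx'; exact/esym/HE.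
  apply: cvgB; last exact: cvg_cst.
  by apply: continuous_comp; [exact: fc|exact: hc].
(* The covering space is the union of all integer translates of the graphs of the [h u] over [u];
   over an overlap these families coincide because the [h u] differ by integers. *)
pose Et : set (Y * R) := [set a | exists2 u, U u & u a.1 /\ exists k : int, a.2 = h u a.1 + k%:~R].
have Et_fiber a a' : Et a -> Et a' -> a.1 = a'.1 -> exists k : int, a.2 - a'.2 = k%:~R.
  move=> [u Uu [ua [k ak]]] [v Uv [va [l al]]] aa.
  exists (cech_val z u v + k - l).
  rewrite ak al -aa opprD addrACA hE//; last by rewrite aa.
  by rewrite !rmorphD rmorphN /= -!addrA.
have Et_shift a (k : int) : Et a -> Et (a.1, a.2 + k%:~R).
  move=> [u Uu [ua [l al]]]; exists u => //; split=> //; exists (l + k).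
  by rewrite al -addrA -rmorphD.
pose L := (fun x => (f x, H x)) @` [set: X].
have sL : subcontinuum L.
  apply: subcontinuum_image; first exact: continuous_pair.
  by have [? _ ? ?] := contX.
have LE : L `<=` Et.
  move=> _ [x _ <-]; have [Wx xx] := wofP x; have [Ux ux] := uofP _ Wx.
  exists (uof (wof x)) => //=; split; first exact: ux.
  by exists (- b (wof x)); rewrite rmorphN.
have iL := subcontinuum_inj_fst hY hiY Et_fiber Et_shift sL LE.
have /choice[g gP] := fsurj.
(* Injectivity of [L] over [Y] says that [H] is constant on the fibres of [f], so [s] does not
   depend on the right inverse [g] and is the section of the covering. *)
pose s := H \o g.
have sf x : s (f x) = H x.
  have : (f (g (f x)), H (g (f x))) = (f x, H x) by apply: iL => //=; [exists (g (f x))|exists x].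
  by case.
have sc : continuous s.
  apply: quotient_continuous; rewrite (_ : s \o f = H)//.
  by apply/funext => x; exact: sf.
(* The integer-valued function [s - h u] need not be constant on [u], so [u] is cut into its level
   sets. They are open: two integers at distance less than 1 are equal. *)
pose sheet (u : set Y) (k : int) := u `&` [set y | s y - h u y = k%:~R].
have osheet u k : U u -> open (sheet u k).
  move=> Uu; rewrite (_ : sheet u k = u `&` (fun y => s y - h u y - k%:~R) @^-1` ball (0 : R) 1).
    apply: openI; first exact: oU.
    have /continuousP : continuous (fun y => s y - h u y - k%:~R).
      by move=> y; apply: cvgB; [apply: cvgB; [exact: sc|exact: hc]|exact: cvg_cst].
    by apply; exact: ball_open.
  apply/seteqP; split=> y [uy /=]; rewrite -ball_normE /= sub0r normrN => syk; split=> //=.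
    by rewrite syk subrr normr0.
  have [x fx] := fsurj y; have [Wx xx] := wofP x; have [Ux ux] := uofP _ Wx.
  have ux' : uof (wof x) y by rewrite -fx; exact: ux.
  have int_s : s y - h u y = (cech_val z (uof (wof x)) u - b (wof x))%:~R.
    by rewrite -fx sf /H rmorphB /= addrAC hE// fx.
  move: syk; rewrite int_s -rmorphB /= => syk; congr _%:~R; apply/eqP; rewrite -subr_eq0.
  apply/negPn/negP => k0; have : (1 : R) <= `|(cech_val z (uof (wof x)) u - b (wof x) - k)%:~R|.
    by apply: norm_intr_ge1; [exact: intr_int|rewrite intr_eq0].
  by rewrite leNgt syk.
pose V := [set w | exists u k, U u /\ w = sheet u k].
(* One set may be a level set in several ways; [uk] fixes a presentation of it. *)
pose uk w := xget (set0, 0 : int) [set p : set Y * int | U p.1 /\ w = sheet p.1 p.2].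
have ukP w : V w -> U (uk w).1 /\ w = sheet (uk w).1 (uk w).2.
  move=> [u [k [Uu wE]]].
  apply: (@xgetPex _ (set0, 0 : int) [set p : set Y * int | U p.1 /\ w = sheet p.1 p.2]).
  by exists (u, k).
exists V, (fst \o uk), (fun=> setT); split.
- split=> [_ [u [k [Uu ->]]]|]; first exact: osheet.
  rewrite -subTset => y _; have [x fx] := fsurj y.
  have [Wx xx] := wofP x; have [Ux ux] := uofP _ Wx.
  exists (sheet (uof (wof x)) (- b (wof x))).
    by exists (uof (wof x)), (- b (wof x)).
  split; first by rewrite -fx; exact: ux.
  by rewrite /= -fx sf /H addrAC subrr sub0r rmorphN.
- by move=> w /ukP[Uw wE]; split=> // y; rewrite {1}wE => -[].
- by move=> w _; split.
exists (fun w => - (uk w).2) => w w' /ukP[Uw wE] /ukP[Uw' wE'] [y [wy wy']].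
rewrite /cech_val_zero /pullback /= sub0r -/U.
have [uy /= ky] : sheet (uk w).1 (uk w).2 y by rewrite -wE.
have [uy' /= ky'] : sheet (uk w').1 (uk w').2 y by rewrite -wE'.
have := hE _ _ y Uw Uw' uy uy'; rewrite opprK.
have -> : h (uk w).1 y - h (uk w').1 y = (s y - h (uk w').1 y) - (s y - h (uk w).1 y).
  lra.
rewrite ky ky' -rmorphB /= => /eqP; rewrite eqr_int => /eqP <-.
by rewrite opprB addrC.
Qed.

End Kernel.

(** Independence has finite character: a finite sequence in the union of a chain already lies in one
    member of the chain. *)
Lemma maximal_Zindependent_ex (G : zmodType) (S : set G) : Zindependent S ->
  exists2 T, S `<=` T & maximal_Zindependent T.
Proof.
move=> iS; have [|A [iA Amax]] := @Zorn_bigcup G [set A | Zindependent (S `|` A)].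
  move=> F FP totF s k us sF s0 g gs.
  have [B [iB sB]] : exists B, Zindependent (S `|` B) /\ [set` s] `<=` S `|` B.
    have [[B0 FB0]|F0] := pselect (F !=set0); last first.
      exists set0; split; first by rewrite setU0.
      move=> x /sF[Sx|[B FB]]; first by left.
      by case: F0; exists B.
    suff [B FB sB] : exists2 B, F B & [set` s] `<=` S `|` B.
      by exists B; split=> //; exact: FP.
    elim: s sF {us s0 gs} => [|x s ih] sF; first by exists B0.
    have [|B FB sB] := ih; first by move=> y ys; apply: sF; rewrite /= inE; apply/orP; right.
    have [C FC [BC xC]] : exists2 C, F C & B `<=` C /\ (S `|` C) x.
      have : (S `|` \bigcup_(X in F) X) x by apply: sF; rewrite /= inE eqxx.
      case=> [Sx|[C FC Cx]]; first by exists B => //; split=> //; left.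
      have [BC|CB] := totF _ _ FB FC; first by exists C => //; split=> //; right.
      by exists B => //; split=> //; right; exact: CB.
    exists C => // y /=; rewrite inE => /orP[/eqP -> //|/sB[Sy|By]]; first by left.
    by right; exact: BC.
  exact: (iB s k).
exists (S `|` A); first exact: subsetUl.
split=> // T iT ST; apply/seteqP; split=> //.
have AT : A `<=` T by move=> x Ax; apply: ST; right.
have [TA|nTA] := pselect (T `<=` A); first by move=> x /TA Ax; right.
case: (Amax T); first by split.
by rewrite /= (setUidr _) // => x Sx; apply: ST; left.
Qed.

(** A map with trivial kernel carries a maximal independent set injectively onto an independent one,
    which is then enlarged to a maximal one. *)
Lemma additive_rank_le (G H : zmodType) (phi : {additive G -> H}) :
  (forall g, phi g = 0 -> g = 0) -> rank_le G H.
Proof.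
move=> phi0; have phi_inj : injective phi by apply: raddf_inj.
have iempty : Zindependent (set0 : set G).
  by move=> s k _ s0 _ g /s0.
have [S _ mS] := maximal_Zindependent_ex iempty.
have iphiS : Zindependent (phi @` S).
  move=> s k us sS s0 h hs.
  have /choice[psi psiP] : forall h, exists g, h \in s -> S g /\ phi g = h.
    move=> h'; have [/sS[g Sg gh]|nh] := boolP (h' \in s); first by exists g.
    by exists 0.
  have [iS _] := mS.
  have psiK : {in s, cancel psi phi} by move=> x /psiP[].
  have <- : k (phi (psi h)) = k h by rewrite psiK.
  apply: (iS (map psi s) (k \o phi)) => //.
  - by rewrite map_inj_in_uniq// => x y xs ys /(congr1 phi); rewrite !psiK.
  - by move=> g /mapP[x xs ->]; have [] := psiP _ xs.
  - apply: phi0; rewrite raddf_sum big_map -[RHS]s0; apply: eq_big_seq => x xs.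
    by rewrite /= raddfMz psiK.
  - exact: map_f.
have [T ST mT] := maximal_Zindependent_ex iphiS.
exists S, T; split=> //; apply: card_le_trans (subset_card_le ST).
have /card_esym := inj_card_eq (in2W phi_inj : {in S &, injective phi}).
by rewrite card_eq_le => /andP[].
Qed.

Section RankH1.
Local Open Scope quotient_scope.
Variables (R : realType) (X Y : topologicalType) (f : X -> Y).
Hypotheses (fc : continuous f) (fsurj : forall y, exists x, f x = y).

Definition H1pull (a : cechH1 Y) : cechH1 X := \pi_(cechH1 X) (cech_pull fc fsurj (repr a)).

Lemma H1pull_additive : {morph H1pull : a b / a + b}.
Proof.
move=> a b; rewrite /H1pull [RHS]H1add_pi; apply/cechH1_eq.
apply: cech_equiv_trans (cech_pull_add fc fsurj _ _).
by apply: cech_pull_equiv; exact: cech_repr.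
Qed.

Lemma H1pull_eq0 a : continuum X -> continuum Y -> hereditarily_indecomposable Y ->
  H1pull a = 0 -> a = 0.
Proof.
move=> cX cY hi /cechH1_eq h; rewrite -[a]reprK; apply/cechH1_eq.
exact: cech_pull_eq0 h.
Qed.

Lemma rank_le_H1 : continuum X -> continuum Y -> hereditarily_indecomposable Y ->
  rank_le (cechH1 Y) (cechH1 X).
Proof.
move=> cX cY hi.
have H1pull0 : H1pull 0 = 0 by apply: (addrI (H1pull 0)); rewrite -H1pull_additive !addr0.
have H1pullN b : H1pull (- b) = - H1pull b.
  by apply: (addIr (H1pull b)); rewrite -H1pull_additive !addNr.
have H1pullB : zmod_morphism H1pull by move=> a b; rewrite H1pull_additive H1pullN.
pose phi : {additive cechH1 Y -> cechH1 X} :=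
  HB.pack H1pull (GRing.isZmodMorphism.Build (cechH1 Y) (cechH1 X) H1pull H1pullB).
by apply: (@additive_rank_le _ _ phi) => g; exact: H1pull_eq0.
Qed.
End RankH1.

(** * Products and subspaces *)

Lemma cvg_initial (S : choiceType) (T : topologicalType) (f : S -> T)
  (F : set_system S) (s : S) : Filter F ->
  f @ F --> f s -> F --> (s : initial_topology f).
Proof.
move=> FF cF A /= [_ [[B oB <-] Bs] BA].
by apply: filterS BA _; apply: cF; exact: open_nbhs_nbhs.
Qed.

Lemma ptws_cvg (T : Type) (V : topologicalType) (F : set_system {ptws T -> V})
  (g : {ptws T -> V}) : Filter F ->
  (forall t, (fun h : {ptws T -> V} => h t) @ F --> g t) -> F --> g.
Proof. by move=> FF cF; apply/cvg_sup => t; exact: cvg_initial. Qed.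

Lemma continuous_ptws (X : topologicalType) (T : Type) (V : topologicalType)
  (f : X -> {ptws T -> V}) :
  (forall t, continuous (fun x => f x t)) -> continuous f.
Proof. by move=> cf x; apply: ptws_cvg => t; exact: cf. Qed.

Lemma ptws_eval_continuous (T : eqType) (V : topologicalType) (t : T) :
  continuous (fun f : {ptws T -> V} => f t).
Proof. exact: (@proj_continuous T (fun=> V) t). Qed.

Lemma hausdorff_inj (X Y : topologicalType) (f : X -> Y) :
  injective f -> continuous f -> hausdorff_space Y -> hausdorff_space X.
Proof.
move=> fI cf hY x x' cl; apply/fI/hY => A B xA xB.
by have [z [Az Bz]] := cl _ _ (cf x A xA) (cf x' B xB); exists (f z).
Qed.

Lemma hausdorff_ptws (T : eqType) (V : topologicalType) :
  hausdorff_space V -> hausdorff_space {ptws T -> V}.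
Proof. by move=> hV; exact: (@hausdorff_product T (fun=> V)). Qed.

Section Subtype.
Variables (X : topologicalType) (L : set X).

Lemma set_val_continuous : continuous (set_val : set_type L -> X).
Proof. exact: initial_continuous. Qed.

Lemma hausdorff_set_type : hausdorff_space X -> hausdorff_space (set_type L).
Proof.
by move=> hX; apply: (hausdorff_inj _ set_val_continuous hX); exact: val_inj.
Qed.

Lemma compact_set_type : compact L -> compact [set: set_type L].
Proof.
move=> cL F FF _; have [|x [Lx cx]] := cL (set_val @ F) _.
  by rewrite /= nbhs_simpl; apply: filterS filterT => p _; exact: set_valP.
pose p : set_type L := SigSub (mem_set Lx); exists p; split=> // A B FA [_ [[C oC <-] Cp] CB].
have [||y [[a Aa <-] Ca]] := cx (set_val @` A) C.
- by rewrite /= nbhs_simpl; apply: filterS FA => a Aa; exists a.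
- exact: open_nbhs_nbhs.
- by exists a; split=> //; exact: CB.
Qed.

Lemma connected_set_type : connected L -> connected [set: set_type L].
Proof.
move=> cL B [b Bb] [_ [C oC <-] BC] [D cD BD].
have [D' oD' DE] : open (~` D) by rewrite openC.
have BL : set_val @` B = L.
  apply: cL; first by exists (set_val b), b.
  - exists C => //; apply/seteqP; split=> [_ [a Ba <-]|x [Lx Cx]].
      by split; [exact: set_valP|move: Ba; rewrite BC => -[]].
    by exists (SigSub (mem_set Lx)) => //; rewrite BC.
  - exists (~` D'); first by rewrite closedC.
    have BE a : B a <-> ~ D' (set_val a).
      rewrite BD; split=> [[_ Da] D'a|nDa]; last split=> //.
        by have : (~` D) a by rewrite -DE.
      by apply: contrapT => nDa'; apply: nDa; have : (~` D) a by []; rewrite -DE.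
    apply/seteqP; split=> [_ [a Ba <-]|x [Lx Cx]].
      by split; [exact: set_valP|exact/BE].
    by exists (SigSub (mem_set Lx)) => //; exact/BE.
apply/seteqP; split=> // p _.
suff : (set_val @` B) (set_val p) by move=> [q Bq /val_inj <-].
by rewrite BL; exact: set_valP.
Qed.

Lemma continuum_set_type : hausdorff_space X -> subcontinuum L -> continuum (set_type L).
Proof.
move=> hX [[x Lx] cL conL]; split.
- by exists (SigSub (mem_set Lx)).
- exact: hausdorff_set_type.
- exact: compact_set_type.
- exact: connected_set_type.
Qed.

End Subtype.

(** * A continuum realizing all extension types *)

Section Construction.
Variables (R : realType) (Y : topologicalType) (V : topologicalType).
Hypothesis contY : continuum Y.
Hypothesis hV : hausdorff_space V.

Variables (v0 : V) (disc : nat -> set V) (sc : R -> V -> V).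
Hypothesis disc0 : forall r, disc r v0.
Hypothesis disc_compact : forall r, compact (disc r).
Hypothesis scC : forall v, continuous (fun s => sc s v).
Hypothesis sc1 : forall v, sc 1 v = v.
Hypothesis sc0 : forall v, sc 0 v = v0.
Hypothesis sc_disc : forall r s v, 0 <= s <= 1 -> disc r v -> disc r (sc s v).

Variables (cbox : countType) (cb : cbox -> set V).
Hypothesis cb_open : forall k, open (cb k).
Hypothesis cb_basis : forall v A, nbhs v A -> exists2 k, cb k v & cb k `<=` A.

Variables (I : choiceType) (yb : I -> set Y).
Hypothesis yb_open : forall k, open (yb k).
Hypothesis yb_basis : forall y A, nbhs y A -> exists2 k, yb k y & yb k `<=` A.

(* The continuum is sought in [P = Y * (T -> V)]. The coordinates [(i, _)] are
   reserved for the function demanded by the index [i]; its component [(l, r)] is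
   bounded by [disc r], so that [l] numbers the variables of a formula and [r] is
   the radius of their domain of quantification. A box is a basic open set of
   [P * Q], and [dec i] lists the boxes among which the graph must pass. *)
Definition box : Type := (I * seq ((I * (nat * nat)) * cbox) * seq ((nat * nat) * cbox))%type.
Variable dec : I -> seq box.
Hypothesis dec_surj : forall s, exists i, dec i = s.

Local Notation T := (I * (nat * nat))%type.
Local Notation Q := {ptws (nat * nat)%type -> V}.
Local Notation F := {ptws T -> V}.
Local Notation P := (Y * F)%type.
Implicit Types (J : set I) (L : set P) (p : P) (q : Q) (b : box).

Definition in_box b p q := [/\ yb b.1.1 p.1,
  forall c, c \in b.1.2 -> cb c.2 (p.2 c.1) & forall c, c \in b.2 -> cb c.2 (q c.1)].

(** Membership in such a box is unaffected by truncation to [J], so a requirement once satisfied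
    stays satisfied in all later extensions. *)
Definition box_over J b := forall c, c \in b.1.2 -> J c.1.1.

Definition slot (i : I) p : Q := fun t => p.2 (i, t).

(** Truncations play the part of the bonding maps of an inverse system, all of whose stages are
    subsets of the one space [P]. *)
Definition trunc J p : P := (p.1, fun t => if `[< J t.1 >] then p.2 t else v0).

Definition bounded_pt p := forall t, disc t.2.2 (p.2 t).

(* [J] is the set of indices already satisfied. *)
Definition good (JL : set I * set P) := let J := JL.1 in let L := JL.2 in
  [/\ subcontinuum L,
      forall p, L p -> bounded_pt p /\ trunc J p = p,
      forall y, exists2 p, L p & p.1 = y &
      forall i, J i -> [/\ forall b, b \in dec i -> box_over J b,
        forall p, L p -> exists2 b, b \in dec i & in_box b p (slot i p) &
        forall b, b \in dec i -> exists2 p, L p & in_box b p (slot i p)]].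

Lemma hausdorff_P : hausdorff_space P.
Proof.
by apply: hausdorff_prod; [case: contY|exact: hausdorff_ptws].
Qed.

Lemma coord_continuous (t : T) : continuous (fun p => p.2 t).
Proof.
move=> p; apply: (@continuous_comp _ _ _ snd (fun h : F => h t)); first exact: cvg_snd.
exact: ptws_eval_continuous.
Qed.

Lemma continuous_P (Z : topologicalType) (f : Z -> P) :
  continuous (fun z => (f z).1) -> (forall t, continuous (fun z => (f z).2 t)) -> continuous f.
Proof.
move=> c1 c2; have -> : f = fun z => ((f z).1, (f z).2) by apply/funext => z; case: (f z).
by apply: continuous_pair => //; exact: continuous_ptws.
Qed.

Lemma slot_continuous i : continuous (slot i).
Proof. by apply: continuous_ptws => t; exact: coord_continuous. Qed.

Lemma trunc_continuous J : continuous (trunc J).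
Proof.
apply: continuous_P => [p|t p]; first exact: cvg_fst.
by rewrite /trunc /=; case: asboolP => _; [exact: coord_continuous|exact: cvg_cst].
Qed.

Lemma trunc_trunc J J' p : J `<=` J' -> trunc J (trunc J' p) = trunc J p.
Proof.
move=> JJ; rewrite /trunc /=; congr pair; apply/funext => t /=.
by case: asboolP => // /JJ Jt; case: asboolP.
Qed.

Lemma trunc_in J p t : J t.1 -> (trunc J p).2 t = p.2 t.
Proof. by rewrite /trunc /=; case: asboolP. Qed.

Lemma in_box_trunc J b p q : box_over J b -> in_box b (trunc J p) q <-> in_box b p q.
Proof.
move=> bJ; have e c : c \in b.1.2 -> (trunc J p).2 c.1 = p.2 c.1.
  by move=> cb1; apply: trunc_in; exact: bJ.
by split=> -[h1 h2 h3]; split=> // c cb1; [rewrite -e//|rewrite e//]; exact: h2.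
Qed.

Lemma slot_trunc J i p : J i -> slot i (trunc J p) = slot i p.
Proof. by move=> Ji; apply/funext => t; rewrite /slot trunc_in. Qed.

Lemma bounded_trunc J p : bounded_pt p -> bounded_pt (trunc J p).
Proof. by move=> bp t; rewrite /trunc /=; case: asboolP. Qed.

Lemma in_box_open (Z : topologicalType) (f : Z -> P) (g : Z -> Q) b :
  continuous f -> continuous g -> open [set z | in_box b (f z) (g z)].
Proof.
move=> fc gc.
have oseq (S : eqType) (s : seq S) (A : S -> set Z) : (forall c, open (A c)) ->
    open [set z | forall c, c \in s -> A c z].
  move=> oA; elim: s => [|c s ih].
    by rewrite (_ : [set _ | _] = setT) -?subTset//; exact: openT.
  rewrite (_ : [set _ | _] = A c `&` [set z | forall c, c \in s -> A c z]); first exact: openI.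
  apply/seteqP; split=> z /=.
    by move=> h; split=> [|d ds]; apply: h; rewrite inE ?eqxx// ds orbT.
  by move=> [Ac h] d; rewrite inE => /orP[/eqP ->|/h].
rewrite (_ : [set _ | _] = (fun z => (f z).1) @^-1` yb b.1.1 `&`
   ([set z | forall c, c \in b.1.2 -> ((fun z => (f z).2 c.1) @^-1` cb c.2) z] `&`
    [set z | forall c, c \in b.2 -> ((fun z => g z c.1) @^-1` cb c.2) z])); last first.
  by apply/seteqP; split=> z /=; [case|case=> ? []].
apply: openI; [|apply: openI; apply: oseq => c].
- have /continuousP : continuous (fun z => (f z).1).
    by move=> z; apply: (@continuous_comp _ _ _ f fst); [exact: fc|exact: cvg_fst].
  by apply; exact: yb_open.
- have /continuousP : continuous (fun z => (f z).2 c.1).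
    by move=> z; apply: (@continuous_comp _ _ _ f (fun p : P => p.2 c.1));
      [exact: fc|exact: coord_continuous].
  by apply; exact: cb_open.
- have /continuousP : continuous (fun z => g z c.1).
    by move=> z; apply: (@continuous_comp _ _ _ g (fun h : Q => h c.1));
      [exact: gc|exact: ptws_eval_continuous].
  by apply; exact: cb_open.
Qed.

(* [cyl J L] frees the coordinates outside [J]; it retracts onto [L] along
   segments, and decreases along the extension order. *)
Definition cyl J L : set P := [set p | bounded_pt p /\ L (trunc J p)].

Lemma cyl_subcontinuum J L : good (J, L) -> subcontinuum (cyl J L).
Proof.
move=> [sL bL _ _]; have [[p0 Lp0] cL conL] := sL.
have Lcyl : L `<=` cyl J L by move=> p Lp; have [bp tp] := bL _ Lp; split=> //; rewrite tp.
split; first by exists p0; exact: Lcyl.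
- have cb0 : compact [set p | bounded_pt p].
    have [_ _ cY _] := contY.
    rewrite (_ : [set _ | _] = [set: Y] `*` [set h : F | forall t, disc t.2.2 (h t)]); last first.
      by apply/seteqP; split=> p //= [].
    apply: compact_setX => //.
    exact: (@tychonoff T (fun=> V) (fun t => disc t.2.2) (fun t => @disc_compact t.2.2)).
  apply: (subclosed_compact _ cb0); last by move=> p [].
  rewrite (_ : cyl J L = [set p | bounded_pt p] `&` trunc J @^-1` L)//.
  apply: closedI; first exact: (compact_closed hausdorff_P cb0).
  apply: (continuous_closedP _).1; first exact: trunc_continuous.
  exact: (compact_closed hausdorff_P cL).
(* Scaling the free coordinates joins [trunc J p], at [s = 0], to [p], at [s = 1], without leaving
   the cylinder. *)
pose mv p (s : R) : P := (p.1, fun t => if `[< J t.1 >] then p.2 t else sc s (p.2 t)).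
have mvC p : continuous (mv p).
  apply: continuous_P => [s|t s]; first exact: cvg_cst.
  by rewrite /mv /=; case: asboolP => _; [exact: cvg_cst|exact: scC].
have mv1 p : mv p 1 = p.
  rewrite /mv [RHS]surjective_pairing; congr pair; apply/funext => t.
  by case: asboolP; rewrite ?sc1.
have mv0 p : mv p 0 = trunc J p.
  by rewrite /mv /trunc; congr pair; apply/funext => t; rewrite sc0.
have mvt p s : trunc J (mv p s) = trunc J p.
  rewrite /mv /trunc /=; congr pair; apply/funext => t /=; by case: asboolP.
pose seg p := mv p @` `[0, 1]%classic.
have segcyl p : cyl J L p -> seg p `<=` cyl J L.
  move=> [bp tp] _ [s /= s01 <-]; split; last by rewrite mvt.
  move=> t; rewrite /mv /=; case: asboolP => _; first exact: bp.
  by apply: sc_disc; [move: s01; rewrite in_itv|exact: bp].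
have -> : cyl J L = \bigcup_(p in cyl J L) (L `|` seg p).
  apply/seteqP; split=> p; last by move=> [p' cp' [/Lcyl|/(segcyl _ cp')]].
  move=> cp; exists p => //; right; exists 1; last exact: mv1.
  by rewrite /= in_itv /= ler01 lexx.
apply: bigcup_connected; first by exists p0 => p _; left.
move=> p [bp tp]; apply: connectedU => //.
  exists (trunc J p); split=> //; exists 0; last exact: mv0.
  by rewrite /= in_itv /= ler01 lexx.
apply: connected_image; first exact: mvC.
exact: segment_connected.
Qed.

Definition extends (s s' : set I * set P) := s.1 `<=` s'.1 /\ trunc s.1 @` s'.2 = s.2.

Lemma extends_refl s : good s -> extends s s.
Proof.
move=> [_ bL _ _]; split=> //; apply/seteqP; split=> [_ [p Lp <-]|p Lp].
  by have [_ ->] := bL _ Lp.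
by exists p => //; have [] := bL _ Lp.
Qed.

Lemma extends_trans s1 s2 s3 : extends s1 s2 -> extends s2 s3 -> extends s1 s3.
Proof.
move=> [J12 L12] [J23 L23]; split; first exact: subset_trans J23.
rewrite -L12 -L23; apply/seteqP; split=> [_ [p Lp <-]|_ [_ [p Lp <-] <-]].
  by exists (trunc s2.1 p); [exists p|exact: trunc_trunc].
by exists p => //; rewrite trunc_trunc.
Qed.

Lemma extends_cyl s s' : extends s s' -> cyl s'.1 s'.2 `<=` cyl s.1 s.2.
Proof.
move=> [JJ LL] p [bp tp]; split=> //; rewrite -LL.
by exists (trunc s'.1 p) => //; exact: trunc_trunc.
Qed.

(* The union of a chain is the truncation of the intersection of the [cyl]s. *)
Lemma good_chain_bound (A : set (set I * set P)) :
  A !=set0 -> A `<=` good -> total_on A extends ->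
  exists2 s, good s & forall a, A a -> extends a s.
Proof.
move=> [a0 Aa0] Ag totA.
pose c (a : set I * set P) := cyl a.1 a.2.
have cP a : A a -> subcontinuum (c a).
  by case: a => J L Aa; apply: cyl_subcontinuum; exact: Ag.
have dirA : directed A c.
  split; first by exists a0.
  move=> a b Aa Ab; have [/extends_cyl ab|/extends_cyl ba] := totA _ _ Aa Ab.
    by exists b => // p cp; split=> //; exact: ab.
  by exists a => // p cp; split=> //; exact: ba.
pose K := \bigcap_(a in A) c a.
have sK : subcontinuum K by apply: directed_bigcap_subcontinuum => //; exact: hausdorff_P.
pose Jm : set I := \bigcup_(a in A) a.1.
pose Lm := trunc Jm @` K.
have JJm a : A a -> a.1 `<=` Jm by move=> Aa i ai; exists a.
(* The limit projects onto each stage: the fibres over [q] in the cylinders of later stages are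
   nonempty, compact and directed. *)
have lift a (q : P) : A a -> a.2 q -> exists2 p, K p & trunc a.1 p = q.
  move=> Aa aq.
  pose D := [set b | A b /\ extends a b].
  pose f (b : set I * set P) := c b `&` trunc a.1 @^-1` [set q].
  have Da : D a by split=> //; exact/extends_refl/Ag.
  have [||p pD] := @directed_bigcap_nonempty P _ D f hausdorff_P.
  - split; first by exists a.
    move=> b b' [Ab ab] [Ab' ab']; have [/extends_cyl bb|/extends_cyl bb] := totA _ _ Ab Ab'.
      by exists b' => // p [cp tp]; split; split=> //; exact: bb.
    by exists b => // p [cp tp]; split; split=> //; exact: bb.
  - move=> b [Ab ab]; split.
      apply: compact_closedI; first by have [] := cP _ Ab.
      apply: (continuous_closedP _).1; first exact: trunc_continuous.
      apply: accessible_closed_set1; exact: hausdorff_accessible hausdorff_P.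
    have [_ LL] := ab; move: aq; rewrite -LL => -[p bp pq]; exists p; split=> //.
    by have [_ bL _ _] := Ag _ Ab; have [bdp tp] := bL _ bp; split=> //; rewrite tp.
  exists p; last by have [] := pD _ Da.
  move=> b Ab; have [ab|/extends_cyl ba] := totA _ _ Aa Ab; first by have [] := pD b (conj Ab ab).
  by apply: ba; have [] := pD _ Da.
have extm a : A a -> extends a (Jm, Lm).
  move=> Aa; split; first exact: JJm.
  apply/seteqP; split=> [_ [_ [p Kp <-] <-]|q aq].
    by rewrite trunc_trunc; [have [] := Kp _ Aa|exact: JJm].
  have [p Kp pq] := lift _ _ Aa aq; exists (trunc Jm p); first by exists p.
  by rewrite trunc_trunc//; exact: JJm.
exists (Jm, Lm) => //; split=> /=.
- by apply: subcontinuum_image => //; exact: trunc_continuous.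
- move=> _ [p Kp <-]; split; last exact: trunc_trunc.
  by apply: bounded_trunc; have [] := Kp _ Aa0.
- move=> y; have [_ _ /(_ y)[q aq qy] _] := Ag _ Aa0.
  have [p Kp pq] := lift _ _ Aa0 aq; exists (trunc Jm p); first by exists p.
  by rewrite -qy -pq.
- move=> i [a Aa ai]; have [_ _ _ /(_ _ ai)[over1 in1 ex1]] := Ag _ Aa.
  split=> [b bi t tb|_ [p Kp <-]|b bi].
  + by exists a => //; exact: over1 bi _ tb.
  + have [_ /in1[b bi bp]] := Kp _ Aa; exists b => //.
    have Ji : Jm i by exists a.
    rewrite slot_trunc//; rewrite slot_trunc// in bp.
    apply/in_box_trunc; first by move=> t tb; exists a => //; exact: over1 bi _ tb.
    by apply/(in_box_trunc (J := a.1)) => //; exact: over1.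
  + have [q aq bq] := ex1 _ bi; have [p Kp pq] := lift _ _ Aa aq.
    exists (trunc Jm p); first by exists p.
    have Ji : Jm i by exists a.
    rewrite slot_trunc//; apply/in_box_trunc.
      by move=> t tb; exists a => //; exact: over1 bi _ tb.
    apply/(in_box_trunc (J := a.1)); first exact: over1.
    by rewrite pq -(slot_trunc p ai) pq.
Qed.

Lemma good0 : good (set0, (fun y => (y, fun=> v0)) @` [set: Y]).
Proof.
have [[y0 _] hY cY conY] := contY; split=> /=.
- apply: subcontinuum_image; last by split=> //; exists y0.
  by apply: continuous_P => [y|t y]; [exact: cvg_id|exact: cvg_cst].
- move=> _ [y _ <-]; split; first by move=> t /=; exact: disc0.
  by rewrite /trunc /=; congr pair; apply/funext => t; case: asboolP.
- by move=> y; exists (y, fun=> v0) => //; exists y.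
- by [].
Qed.

Lemma maximal_good : exists2 s, good s &
  forall s', good s' -> extends s s' -> extends s' s.
Proof.
pose S := {s : set I * set P | good s}.
pose Rl (s s' : S) := `[< extends (sval s) (sval s') >].
have [|||s smax] := @ZL_preorder S (exist _ _ good0) Rl.
- by move=> [s gs]; apply/asboolP; exact: extends_refl.
- by move=> r s t /asboolP rs /asboolP st; apply/asboolP; exact: extends_trans st.
- move=> A totA; have [[a0 Aa0]|A0] := pselect (A !=set0); last first.
    by exists (exist _ _ good0) => a Aa; case: A0; exists a.
  have [|||s gs sA] := @good_chain_bound (sval @` A).
  + by exists (sval a0), a0.
  + by move=> _ [a _ <-]; exact: svalP.
  + by move=> _ _ [a Aa <-] [b Ab <-]; have [/asboolP|/asboolP] := totA _ _ Aa Ab; [left|right].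
  + by exists (exist _ _ gs) => a Aa; apply/asboolP/sA; exists a.
exists (sval s); first exact: svalP.
move=> s' gs' ss'; apply/asboolP; apply: (smax (exist _ _ gs')); exact/asboolP.
Qed.

(** * The maximal continuum: its base and its approximation property *)

Section Limit.
Variables (J : set I) (L : set P).
Hypothesis goodL : good (J, L).
Hypothesis maxL : forall s', good s' -> extends (J, L) s' -> extends s' (J, L).
Let X : topologicalType := set_type L.

Let valC : continuous (set_val : X -> P).
Proof. exact: set_val_continuous. Qed.

Let LP (p : X) : L (set_val p). Proof. exact: set_valP. Qed.

Lemma limit_continuum : continuum X.
Proof.
by have [sL _ _ _] := goodL; apply: continuum_set_type => //; exact: hausdorff_P.
Qed.

Lemma limit_proj : continuous (fun p : X => (set_val p).1).
Proof.
by move=> p; apply: (@continuous_comp _ _ _ set_val fst); [exact: valC|exact: cvg_fst].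
Qed.

Lemma limit_proj_surj y : exists p : X, (set_val p).1 = y.
Proof.
have [_ _ /(_ y)[p Lp py] _] := goodL.
by exists (SigSub (mem_set Lp)).
Qed.

(* The coordinates outside [J] vanish on [L], so boxes over [J] suffice. *)
Lemma box_nbhs (p : X) (q : Q) (W : set (X * Q)) : nbhs (p, q) W ->
  exists b, [/\ box_over J b, in_box b (set_val p) q &
    forall (p' : X) (q' : Q), in_box b (set_val p') q' -> W (p', q')].
Proof.
(* The boxes over [J] around the point generate a filter, so it suffices that this filter converges
   to the point, which can be tested coordinate by coordinate. *)
pose Fl : set_system (X * Q) := [set W | exists b, [/\ box_over J b,
  in_box b (set_val p) q & forall (p' : X) (q' : Q), in_box b (set_val p') q' -> W (p', q')]].
pose bY k : box := (k, [::], [::]).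
pose bP k t v : box := (k, [:: (t, v)], [::]).
pose bQ k t v : box := (k, [::], [:: (t, v)]).
have [k0 k0p _] : exists2 k, yb k (set_val p).1 & yb k `<=` setT.
  exact: yb_basis filterT.
have FF : Filter Fl.
  split.
  - by exists (bY k0); split.
  - move=> A B [b [bJ bp bA]] [b' [bJ' bp' bB]].
    have [b1 b2 b3] := bp; have [b1' b2' b3'] := bp'.
    have [k kp kbb] : exists2 k, yb k (set_val p).1 & yb k `<=` yb b.1.1 `&` yb b'.1.1.
      by apply: yb_basis; apply: filterI; apply: open_nbhs_nbhs; split.
    exists (k, b.1.2 ++ b'.1.2, b.2 ++ b'.2); split.
    + by move=> c; rewrite mem_cat => /orP[/bJ|/bJ'].
    + split=> //= c; rewrite mem_cat => /orP[]; [exact: b2|exact: b2'|exact: b3|exact: b3'].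
    + move=> p' q' [/= /kbb[y1 y2] h2 h3]; split; [apply: bA|apply: bB]; split=> // c cb1.
      * by apply: h2; rewrite mem_cat cb1.
      * by apply: h3; rewrite mem_cat cb1.
      * by apply: h2; rewrite mem_cat cb1 orbT.
      * by apply: h3; rewrite mem_cat cb1 orbT.
  - by move=> A B AB [b [bJ bp bA]]; exists b; split=> // p' q' /bA /AB.
suff : Fl --> (p, q) by apply.
move=> W' [[A B] /= [pA qB] AB].
have cp : fst @ Fl --> p.
  apply: cvg_initial.
  have c1 : (fun w : X * Q => (set_val w.1).1) @ Fl --> (set_val p).1.
    move=> U pU; have [k kp kU] := yb_basis pU.
    by exists (bY k); split=> // p' q' [/kU].
  have c2 : (fun w : X * Q => (set_val w.1).2) @ Fl --> (set_val p).2.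
    apply: ptws_cvg => t U pU.
    have [Jt|nJt] := pselect (J t.1).
      have [k kp kU] := cb_basis pU.
      exists (bP k0 t k); split.
      + by move=> c; rewrite inE => /eqP ->.
      + by split=> // c; rewrite inE => /eqP ->.
      + by move=> p' q' [_ /(_ (t, k)) h _]; apply: kU; apply: h; rewrite inE.
    exists (bY k0); split=> // p' q' _ /=.
    have v0E (p1 : X) : (set_val p1).2 t = v0.
      have [_ /(_ _ (LP p1))[_ <-] _ _] := goodL.
      by rewrite /trunc /=; case: asboolP.
    by rewrite v0E -(v0E p); exact: nbhs_singleton.
  move=> U [[A1 B1] [/= h1 h2] AB1].
  suff : Fl [set w | U (set_val w.1)] by [].
  have F1 : Fl [set w | A1 (set_val w.1).1] by exact: c1.
  have F2 : Fl [set w | B1 (set_val w.1).2] by exact: c2.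
  by apply: filterS (filterI F1 F2) => w [w1 w2]; exact: AB1.
have cq : snd @ Fl --> q.
  apply: ptws_cvg => t U qU; have [k kq kU] := cb_basis qU.
  exists (bQ k0 t k); split=> //.
    by split=> // c; rewrite inE => /eqP ->.
  by move=> p' q' [_ _ /(_ (t, k)) h]; apply: kU; apply: h; rewrite inE.
have F1 : Fl (fst @^-1` A) by exact: cp.
have F2 : Fl (snd @^-1` B) by exact: cq.
apply: filterS (filterI F1 F2) => w [wA wB]; exact: (AB w (conj wA wB)).
Qed.

Let q0 : Q := fun=> v0.

(** Freezing the second point turns boxes of the product with [Q] into a base of [X] indexed by
    [box]; this bounds the weight of [X] from above. *)
Lemma limit_basis : basis [set [set w : X | in_box b (set_val w) q0] | b in [set: box]].
Proof.
split=> [_ [b _ <-]|w W wW].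
  by apply: (@in_box_open X set_val (fun=> q0) b valC); exact: cst_continuous.
have [|b [bJ bw bW]] := @box_nbhs w q0 (fst @^-1` W); first exact: cvg_fst.
exists [set w' | in_box b (set_val w') q0]; first by split=> //; exists b.
by move=> w' /bW.
Qed.

Section Approximation.
Variables (Z : topologicalType) (f : Z -> X) (x : Z -> Q).
Hypotheses (contZ : continuum Z) (fc : continuous f) (fsurj : forall w, exists z, f z = w).
Hypotheses (xc : continuous x) (xdisc : forall z t, disc t.2 (x z t)).

Let vfc : continuous (set_val \o f : Z -> P).
Proof. by move=> z; apply: continuous_comp; [exact: fc|exact: valC]. Qed.

(* Otherwise filling the slot [i] with [x] would extend the maximal [(J, L)]. *)
Lemma slot_in i : (forall b, b \in dec i -> box_over J b) ->
  (forall z, exists2 b, b \in dec i & in_box b (set_val (f z)) (x z)) ->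
  (forall b, b \in dec i -> exists z, in_box b (set_val (f z)) (x z)) -> J i.
Proof.
move=> over_i cov hit; apply: contrapT => nJi.
(* The values of [x] are written into block [i]. As [i] lies outside [J], truncation to [J] gives
   back [f], so everything already satisfied persists. *)
pose ext z : P := ((set_val (f z)).1,
  fun t => if t.1 == i then x z t.2 else (set_val (f z)).2 t).
have [sL bL pL gL] := goodL; rewrite /= in sL bL pL gL.
have extC : continuous ext.
  apply: continuous_P => [z|t z].
    by apply: (@continuous_comp _ _ _ f (fun w : X => (set_val w).1));
      [exact: fc|exact: limit_proj].
  rewrite /ext /=; case: (t.1 == i).
    by apply: (@continuous_comp _ _ _ x (fun h : Q => h t.2));
      [exact: xc|exact: ptws_eval_continuous].
  by apply: (@continuous_comp _ _ _ (set_val \o f) (fun p : P => p.2 t));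
    [exact: vfc|exact: coord_continuous].
have ext_val z : trunc J (ext z) = set_val (f z).
  have [_ <-] := bL _ (LP (f z)); rewrite /trunc /=; congr pair; apply/funext => t.
  case: asboolP => // Jt; case: eqP => // ti.
  by rewrite ti in Jt.
have ext_slot z : slot i (ext z) = x z by apply/funext => t; rewrite /slot /= eqxx.
have ext_box z b q : box_over J b -> in_box b (ext z) q <-> in_box b (set_val (f z)) q.
  by move=> bJ; rewrite -(in_box_trunc (ext z) q bJ) ext_val.
have ext_slotj z j : J j -> slot j (ext z) = slot j (set_val (f z)).
  by move=> Jj; rewrite -(slot_trunc (ext z) Jj) ext_val.
pose J' := J `|` [set i]; pose L' := ext @` [set: Z].
have JJ' b : box_over J b -> box_over J' b by move=> bJ c /bJ; left.
have g' : good (J', L').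
  split=> /=.
  - by apply: subcontinuum_image => //; have [? _ ? ?] := contZ.
  - move=> _ [z _ <-]; have [bz tz] := bL _ (LP (f z)); split.
      by move=> t; rewrite /ext /=; case: eqP => // _; exact: xdisc.
    rewrite /trunc /=; congr pair; apply/funext => t.
    case: asboolP => // nJ't; case: eqP => [ti|_]; first by case: nJ't; right.
    rewrite -tz /trunc /=; case: asboolP => // Jt; by case: nJ't; left.
  - move=> y; have [p Lp py] := pL y; have [z fz] := fsurj (SigSub (mem_set Lp)).
    by exists (ext z); [exists z|rewrite /= fz].
  - move=> j [Jj|->]; last first.
      split=> [b /over_i/JJ'//|_ [z _ <-]|b bi].
        have [b bi bz] := cov z; exists b => //.
        by rewrite ext_slot; apply/ext_box => //; exact: over_i.
      have [z bz] := hit _ bi; exists (ext z); first by exists z.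
      by rewrite ext_slot; apply/ext_box => //; exact: over_i.
    have [overj inj exj] := gL _ Jj; split=> [b /overj/JJ'//|_ [z _ <-]|b bj].
      have [b bj bz] := inj _ (LP (f z)); exists b => //.
      by rewrite ext_slotj//; apply/ext_box => //; exact: overj.
    have [p Lp bp] := exj _ bj; have [z fz] := fsurj (SigSub (mem_set Lp)).
    exists (ext z); first by exists z.
    by rewrite ext_slotj// fz; apply/ext_box; [exact: overj|rewrite fz].
have ee : extends (J, L) (J', L').
  split=> /=; first exact: subsetUl.
  apply/seteqP; split=> [_ [_ [z _ <-] <-]|p Lp]; first by rewrite ext_val.
  have [z fz] := fsurj (SigSub (mem_set Lp)).
  by exists (ext z); [exists z|rewrite ext_val fz].
have [J'J _] := maxL g' ee.
by apply: nJi; apply: J'J; right.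
Qed.

(** By compactness of [Z], finitely many boxes inside [W] cover the graph of [x], and finitely many
    more certify that the sets of [Us] are met. The list of all of them is some [dec i]; [Z] itself
    shows that [i] belongs to [J], and block [i] of [X] is the desired map. *)
Lemma limit_approx (W : set (X * Q)) (Us : seq (set (X * Q))) : open W ->
  (forall U, U \in Us -> open U) -> (forall z, W (f z, x z)) ->
  (forall U, U \in Us -> exists z, U (f z, x z)) ->
  exists x' : X -> Q, [/\ continuous x', forall w t, disc t.2 (x' w t),
    forall w, W (w, x' w) & forall U, U \in Us -> exists w, U (w, x' w)].
Proof.
move=> oW oU Wx Ux.
pose inside b (A : set (X * Q)) := forall (w : X) (q : Q), in_box b (set_val w) q -> A (w, q).
(* All boxes, including those chosen for [Us], are taken inside [W] and meet the graph, so one list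
   can serve both as a cover and as a list of sets to be hit. *)
pose ok (s : seq box) := forall b, b \in s -> [/\ box_over J b, inside b W &
  exists z, in_box b (set_val (f z)) (x z)].
have ok_cat s s' : ok s -> ok s' -> ok (s ++ s').
  by move=> h h' b; rewrite mem_cat => /orP[/h|/h'].
have ok1 z A : open A -> A (f z, x z) -> exists b,
    [/\ ok [:: b], inside b A & in_box b (set_val (f z)) (x z)].
  move=> oA Az; have [|b [bJ bz bWA]] := @box_nbhs (f z) (x z) (W `&` A).
    by apply: open_nbhs_nbhs; split; [exact: openI|split=> //; exact: Wx].
  exists b; split=> //; last by move=> w q /bWA[].
  move=> _ /[!inE] /eqP ->; split=> //; last by exists z.
  by move=> w q /bWA[].
have [s oks scov] : exists2 s, ok s & forall z, [set: Z] z ->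
    exists2 b, b \in s & in_box b (set_val (f z)) (x z).
  have [_ _ cZ _] := contZ.
  apply: (compact_ind (P := fun A => exists2 s, ok s & forall z, A z ->
    exists2 b, b \in s & in_box b (set_val (f z)) (x z)) cZ).
  - by exists [::].
  - move=> A B [s oks sA] [s' oks' sB]; exists (s ++ s'); first exact: ok_cat.
    by move=> z [/sA|/sB] [b bs bz]; exists b => //; rewrite mem_cat bs ?orbT.
  - by move=> A B AB [s oks sB]; exists s => // z /AB/sB.
  - move=> z _; have [b [okb _ bz]] := ok1 _ _ oW (Wx z).
    exists [set z | in_box b (set_val (f z)) (x z)].
      by apply: open_nbhs_nbhs; split=> //; exact: (in_box_open _ vfc xc).
    by exists [:: b] => // z' bz'; exists b; rewrite ?inE.
have [s' oks' sU] : exists2 s', ok s' &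
    forall U, U \in Us -> exists2 b, b \in s' & inside b U.
  elim: Us oU Ux => [|U Us ih] oU Ux; first by exists [::].
  have [||s' oks' sU] := ih.
  - by move=> U' U'U; apply: oU; rewrite inE U'U orbT.
  - by move=> U' U'U; apply: Ux; rewrite inE U'U orbT.
  have UU : U \in U :: Us by rewrite inE eqxx.
  have [z Uz] := Ux _ UU; have [b [okb bU bz]] := ok1 _ _ (oU _ UU) Uz.
  exists ([:: b] ++ s'); first exact: ok_cat.
  move=> U'; rewrite inE => /orP[/eqP ->|/sU[b' bs' b'U]].
    by exists b; rewrite ?inE ?eqxx.
  by exists b' => //; rewrite mem_cat bs' orbT.
have [i di] := dec_surj (s ++ s').
have oki : ok (dec i) by rewrite di; exact: ok_cat.
have Ji : J i.
  apply: slot_in => [b /oki[]//|z|b /oki[]//].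
  by have [b bs bz] := scov z Logic.I; exists b => //; rewrite di mem_cat bs.
have [_ bL _ /(_ _ Ji)[_ inL exL]] := goodL.
exists (fun w => slot i (set_val w)); split.
- by move=> w; apply: (@continuous_comp _ _ _ set_val (slot i));
    [exact: valC|exact: slot_continuous].
- by move=> w t; have [bw _] := bL _ (LP w); exact: (bw (i, t)).
- by move=> w; have [b /oki[_ bW _] bw] := inL _ (LP w); exact: bW.
- move=> U /sU[b bs bU]; have [|p Lp bp] := exL b; first by rewrite di mem_cat bs orbT.
  by exists (SigSub (mem_set Lp)); exact: bU.
Qed.

End Approximation.

End Limit.

End Construction.

(** * The complex plane *)

Section ComplexPlane.
Import ComplexField.Normc.
Local Open Scope complex_scope.
Variable R : realType.
Local Notation C := (R[i] : numClosedFieldType).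
Local Notation cRe := (@complex.Re R).
Local Notation cIm := (@complex.Im R).

Lemma normCE (z : C) : `|z| = (normc z)%:C.
Proof. by []. Qed.

Lemma hausdorff_C : hausdorff_space C.
Proof. exact: norm_hausdorff. Qed.

Lemma real_complex_continuous : continuous (fun r : R => r%:C : C).
Proof.
move=> r; apply/cvgrPdist_lt => e; rewrite ltcE /= => /andP[/eqP e2 e1].
have eE : e = (cRe e)%:C by case: e e1 e2 => a b /= _ ->.
have /cvgrPdist_lt/(_ _ e1) : s @[s --> r] --> r by exact: cvg_id.
by apply: filterS => s; rewrite -rmorphB normCE eE ltcR /normc /= expr0n addr0 sqrtr_sqr.
Qed.

Lemma normc_ge_absRe (z : C) : `|cRe z| <= normc z.
Proof. by rewrite -lecR; exact: normc_ge_Re. Qed.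

Lemma normc_ge_absIm (z : C) : `|cIm z| <= normc z.
Proof.
by case: z => a b; rewrite /= -sqrtr_sqr ler_wsqrtr// lerDr sqr_ge0.
Qed.

Lemma cvg_C_dist (F : set_system C) (z : C) (g : C -> R) : Filter F -> F --> z ->
  (forall w, `|g z - g w| <= normc (z - w)) -> g @ F --> g z.
Proof.
move=> FF Fz gle; apply/cvgrPdist_lt => e e0.
have /cvgrPdist_lt/(_ e%:C) := Fz; rewrite ltcR => /(_ e0).
by apply: filterS => w; rewrite normCE ltcR; exact: le_lt_trans.
Qed.

Lemma Re_continuous : continuous (fun z : C => cRe z).
Proof.
move=> z; apply: (@cvg_C_dist (nbhs z)) => // w.
by rewrite -raddfB; exact: normc_ge_absRe.
Qed.

Lemma Im_continuous : continuous (fun z : C => cIm z).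
Proof.
move=> z; apply: (@cvg_C_dist (nbhs z)) => // w.
by rewrite -raddfB; exact: normc_ge_absIm.
Qed.

Lemma normc_continuous : continuous (fun z : C => normc z).
Proof.
move=> z; apply: (@cvg_C_dist (nbhs z)) => // w.
have h (a b : C) : normc a - normc b <= normc (a - b).
  by rewrite lerBlDr; have := le_normcD (a - b) b; rewrite subrK.
by rewrite ler_norml h andbT lerNl opprB -[z - w]opprB normcN h.
Qed.

Lemma continuous_normc (X : topologicalType) (f : X -> C) :
  continuous f -> continuous (fun x => normc (f x)).
Proof.
move=> fc x; apply: (@continuous_comp _ _ _ f (@normc R)); first exact: fc.
exact: normc_continuous.
Qed.

Lemma complex_continuous (X : topologicalType) (f g : X -> R) :
  continuous f -> continuous g -> continuous (fun x => f x +i* g x : C).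
Proof.
move=> fc gc.
have -> : (fun x => f x +i* g x : C) = (fun x => (f x)%:C + 'i%C * (g x)%:C).
  by apply/funext => x; rewrite [LHS]complexE.
move=> x; apply: cvgD; last apply: cvgM; [|exact: cvg_cst|];
  (apply: continuous_comp; [|exact: real_complex_continuous]); [exact: fc|exact: gc].
Qed.

Definition cdisc (r : nat) : set C := [set z | normc z <= r%:R].

Lemma cdisc0 r : cdisc r 0.
Proof. by rewrite /cdisc /= expr0n /= addr0 sqrtr0. Qed.

Lemma cdisc_compact r : compact (cdisc r).
Proof.
pose sq := [set p : R * R | `|p.1| <= r%:R /\ `|p.2| <= r%:R].
have csq : compact sq.
  have -> : sq = `[- r%:R, r%:R]%classic `*` `[- r%:R, r%:R]%classic.
    by apply/seteqP; split=> -[a b] /=; rewrite !in_itv /= -!ler_norml.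
  by apply: compact_setX; exact: segment_compact.
have cim : compact ((fun p : R * R => p.1 +i* p.2 : C) @` sq).
  apply: compact_image => //; apply: complex_continuous => p.
    exact: cvg_fst.
  exact: cvg_snd.
apply: (subclosed_compact _ cim).
  apply: ((continuous_closedP _).1 normc_continuous [set s | s <= r%:R]).
  exact: closed_le.
move=> z zr; exists (cRe z, cIm z); last by case: z {zr}.
split; apply: le_trans zr; [exact: normc_ge_absRe|exact: normc_ge_absIm].
Qed.

Definition csc (s : R) (z : C) : C := s%:C * z.

Lemma csc_continuous z : continuous (fun s => csc s z).
Proof. by move=> s; apply: cvgM; [exact: real_complex_continuous|exact: cvg_cst]. Qed.

Lemma csc1 z : csc 1 z = z. Proof. exact: mul1r. Qed.
Lemma csc0 z : csc 0 z = 0. Proof. exact: mul0r. Qed.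

Lemma csc_disc r s z : 0 <= s <= 1 -> cdisc r z -> cdisc r (csc s z).
Proof.
move=> /andP[s0 s1] zr; rewrite /cdisc /= normcM.
have -> : normc s%:C = s by rewrite /normc /= expr0n addr0 sqrtr_sqr ger0_norm.
by apply: le_trans zr; rewrite ler_piMl//; case: (z) => a b; rewrite sqrtr_ge0.
Qed.

(** Rational rectangles give a countable base of the plane; no order is imposed on the end points,
    reversed ones giving the empty set. *)
Definition cbox (k : (rat * rat) * (rat * rat)) : set C :=
  [set z | [/\ ratr k.1.1 < cRe z, cRe z < ratr k.1.2, ratr k.2.1 < cIm z & cIm z < ratr k.2.2]].

Lemma cbox_open k : open (cbox k).
Proof.
have -> : cbox k = (fun z : C => cRe z) @^-1` `]ratr k.1.1, ratr k.1.2[%classic `&`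
    (fun z : C => cIm z) @^-1` `]ratr k.2.1, ratr k.2.2[%classic.
  apply/seteqP; split=> z; rewrite /cbox /= !in_itv /=; first by move=> [-> -> -> ->].
  by move=> [/andP[? ?] /andP[]].
apply: openI.
  by move/continuousP: Re_continuous; apply; exact: interval_open.
by move/continuousP: Im_continuous; apply; exact: interval_open.
Qed.

Lemma cbox_basis (z : C) A : nbhs z A -> exists2 k, cbox k z & cbox k `<=` A.
Proof.
move=> zA.
pose h (p : R * R) : C := p.1 +i* p.2.
have hc : continuous h.
  by apply: complex_continuous => p; [exact: cvg_fst|exact: cvg_snd].
have := hc (cRe z, cIm z) A; rewrite /h /= (_ : cRe z +i* cIm z = z); last by case: (z).
move=> /(_ zA)[[B D] /= [zB zD] BD].
have itv (x : R) U : nbhs x U -> exists ab : rat * rat, ratr ab.1 < x < ratr ab.2 /\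
    forall y, ratr ab.1 < y < ratr ab.2 -> U y.
  move=> /nbhs_ballP[e /= e0 eU].
  have /rat_in_itvoo[a] : x - e < x by rewrite ltrBlDr ltrDl.
  have /rat_in_itvoo[b] : x < x + e by rewrite ltrDl.
  rewrite !in_itv /= => /andP[b1 b2] /andP[a1 a2].
  exists (a, b); split=> [|y /andP[y1 y2]]; first by rewrite /= a2.
  by apply: eU; rewrite -ball_normE /= in y1 y2 *; rewrite ltr_distlC; lra.
have [k1 [zk1 k1B]] := itv _ _ zB; have [k2 [zk2 k2D]] := itv _ _ zD.
exists (k1, k2) => /=.
  by case/andP: zk1 => ? ?; case/andP: zk2 => ? ?; split.
move=> w [/= w1 w2 w3 w4].
have := BD (cRe w, cIm w); rewrite /= (_ : cRe w +i* cIm w = w); last by case: (w).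
by apply; split=> /=; [apply: k1B; rewrite w1|apply: k2D; rewrite w3].
Qed.

End ComplexPlane.

(** * Quantifier-free formulas *)

Section Vietoris.
Variable S : topologicalType.
Implicit Types K U : set S.

(** The neighbourhood filter of [K0] in the Vietoris topology: [W] bounds a set from outside, while
    the members of [Us] are sets that it must meet. *)
Definition vietoris K0 : set_system (set S) := [set A | exists W (Us : seq (set S)),
  [/\ open W, forall U, U \in Us -> open U, K0 `<=` W,
      forall U, U \in Us -> K0 `&` U !=set0 &
      forall K, K `<=` W -> (forall U, U \in Us -> K `&` U !=set0) -> A K]].

Global Instance vietoris_filter K0 : Filter (vietoris K0).
Proof.
split.
- by exists setT, [::]; split=> //; exact: openT.
- move=> A B [W [Us [oW oU KW KU WA]]] [W' [Us' [oW' oU' KW' KU' WB]]].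
  exists (W `&` W'), (Us ++ Us'); split.
  + exact: openI.
  + by move=> U; rewrite mem_cat => /orP[/oU|/oU'].
  + by move=> x Kx; split; [exact: KW|exact: KW'].
  + by move=> U; rewrite mem_cat => /orP[/KU|/KU'].
  + move=> K KWW KUs; split; [apply: WA|apply: WB].
    * by move=> x /KWW[].
    * by move=> U UU; apply: KUs; rewrite mem_cat UU.
    * by move=> x /KWW[].
    * by move=> U UU; apply: KUs; rewrite mem_cat UU orbT.
- by move=> A B AB [W [Us [oW oU KW KU WA]]]; exists W, Us; split=> // K KK /(WA _ KK)/AB.
Qed.

End Vietoris.

Section Semantics.
Import ComplexField.Normc.
Local Open Scope complex_scope.
Variables (R : realType) (S : topologicalType) (Vr : Type).
Local Notation C := (R[i] : numClosedFieldType).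
Variable e : Vr -> S -> C.

Fixpoint term_val (t : cstar_term R Vr) (s : S) : C :=
  match t with
  | TVar v => e v s
  | TZero => 0
  | TOne => 1
  | TAdd t1 t2 => term_val t1 s + term_val t2 s
  | TMul t1 t2 => term_val t1 s * term_val t2 s
  | TScale a t1 => a * term_val t1 s
  | TStar t1 => conjc (term_val t1 s)
  end.

(** Terms act pointwise and norms are suprema, so a formula on an algebra of functions sees a space
    only through the set of values of its tuple. [S] is the space of such values, with [e] as its
    coordinate functions. *)
Fixpoint qf_val (phi : qf_formula R Vr) (K : set S) : R :=
  match phi with
  | QFNorm t => sup [set normc (term_val t s) | s in K]
  | QFConnective n f _ phis => f (\row_(i < n) qf_val (phis i) K)
  end.

Lemma qf_eval_val (Z : topologicalType) (k : Z -> S) (E : Vr -> cts_algebra R Z) phi :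
  (forall v z, (E v : continuousType Z C) z = e v (k z)) -> qf_eval E phi = qf_val phi (range k).
Proof.
move=> Ee; have tE t z : (term_eval E t : continuousType Z C) z = term_val t (k z).
  elim: t => [v|||t1 IH1 t2 IH2|t1 IH1 t2 IH2|a t1 IH1|t1 IH1] //=.
  - by rewrite -IH1 -IH2.
  - by rewrite -IH1 -IH2.
  - by rewrite -IH1.
  - by rewrite -IH1.
elim: phi => [t|n f cf phis ih] /=.
  congr sup; apply/seteqP; split=> [_ [z _ <-]|_ [_ [z _ <-] <-]].
    by exists (k z) => //; rewrite -tE.
  by exists z => //; rewrite tE.
by congr f; apply/rowP => i; rewrite !mxE ih.
Qed.

Hypothesis ec : forall v, continuous (e v).

Lemma term_val_continuous t : continuous (term_val t).
Proof.
elim: t => [v|||t1 IH1 t2 IH2|t1 IH1 t2 IH2|a t1 IH1|t1 IH1] x.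
- exact: ec.
- exact: cvg_cst.
- exact: cvg_cst.
- by apply: cvgD; [exact: IH1|exact: IH2].
- by apply: cvgM; [exact: IH1|exact: IH2].
- by apply: cvgM; [exact: cvg_cst|exact: IH1].
- apply/cvgrPdist_lt => r r0.
  have /cvgrPdist_lt/(_ r r0) := IH1 x.
  by apply: filterS => y; rewrite -rmorphB normcJ.
Qed.

Lemma sup_cvg_vietoris (g : S -> R) (K0 : set S) : continuous g -> compact K0 -> K0 !=set0 ->
  (fun K => sup (g @` K)) @ vietoris K0 --> sup (g @` K0).
Proof.
move=> gc cK0 [k0 K0k0]; set m := sup (g @` K0).
have hs : has_sup (g @` K0).
  split; first by exists (g k0), k0.
  have /compact_bounded[M [_ MK]] := compact_image gc cK0.
  exists (M + 1) => _ [k Kk <-]; apply: le_trans (ler_norm _) _.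
  by apply: (MK (M + 1)); [rewrite ltrDl|exists k].
apply/cvgrPdist_lt => r r0.
suff : vietoris K0 [set K | `|m - sup (g @` K)| < r] by [].
have r2 : 0 < r / 2 by rewrite divr_gt0.
(* Confinement to the first open set bounds the supremum above; meeting the second bounds it below.
   The margin [r / 2] turns the weak upper bound into a strict one. *)
exists (g @^-1` [set s | s < m + r / 2]), [:: g @^-1` [set s | m - r / 2 < s]]; split.
- by move/continuousP: gc; apply; exact: open_lt.
- by move=> U; rewrite inE => /eqP ->; move/continuousP: gc; apply; exact: open_gt.
- move=> k Kk /=; rewrite (@le_lt_trans _ _ m)// ?ltrDl//.
  by apply: sup_upper_bound => //; exists k.
- move=> U; rewrite inE => /eqP ->; have [_ [k Kk <-] mk] := sup_adherent r2 hs.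
  by exists k.
- move=> K KW KU.
  have [|k [Kk /= mk]] := KU (g @^-1` [set s | m - r / 2 < s]); first by rewrite inE.
  have ubK : ubound (g @` K) (m + r / 2) by move=> _ [s /KW /= /ltW ? <-].
  have h1 : sup (g @` K) <= m + r / 2 by apply: sup_le_ub => //; exists (g k), k.
  have h2 : g k <= sup (g @` K).
    by apply: sup_upper_bound; [split; [exists (g k), k|exists (m + r / 2)]|exists k].
  by rewrite /= ltr_norml; apply/andP; split; lra.
Qed.

Lemma qf_val_cvg phi (K0 : set S) : compact K0 -> K0 !=set0 ->
  qf_val phi @ vietoris K0 --> qf_val phi K0.
Proof.
move=> cK0 K00; elim: phi => [t|n f cf phis ih] /=.
  by apply: sup_cvg_vietoris => //; apply: continuous_normc; exact: term_val_continuous.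
pose row K : 'rV[R]_n := \row_i qf_val (phis i) K.
apply: (@cvg_comp _ _ _ row f _ (nbhs (row K0))); last exact: cf.
apply/cvg_ballP => r r0.
have : \forall K \near vietoris K0, forall j : 'I_n,
    ball (qf_val (phis j) K0) r (qf_val (phis j) K).
  apply: filter_forall => j; have /cvg_ballP := ih j; exact.
apply: filterS => K h; split=> // i j; rewrite !mxE; exact: h.
Qed.

End Semantics.

(** * Embeddings of algebras of continuous functions *)

Section Gelfand.
Import ComplexField.Normc.
Local Open Scope complex_scope.
Variables (R : realType) (X Z : topologicalType).
Local Notation C := (R[i] : numClosedFieldType).
Local Notation CX := (continuousType X C).
Local Notation CZ := (continuousType Z C).
Hypotheses (contX : continuum X) (contZ : continuum Z).
Variable j : cts_algebra R X -> cts_algebra R Z.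
Hypothesis ej : cstar_embedding j.

Let ev (g : CX) (z : Z) : C := (j g : CZ) z.

Let evD (g h : CX) z : ev (cs_add (g : cts_algebra R X) h) z = ev g z + ev h z.
Proof. by rewrite /ev (emb_add ej). Qed.

Let evM (g h : CX) z : ev (cs_mul (g : cts_algebra R X) h) z = ev g z * ev h z.
Proof. by rewrite /ev (emb_mul ej). Qed.

Let evZ a (g : CX) z : ev (cs_scale a (g : cts_algebra R X)) z = a * ev g z.
Proof. by rewrite /ev (emb_scale ej). Qed.

Let ev1 z : ev (cs_one (cts_algebra R X)) z = 1.
Proof. by rewrite /ev (emb_one ej). Qed.

Let ev0 z : ev (cs_zero (cts_algebra R X)) z = 0.
Proof. by rewrite /ev (emb_zero ej). Qed.

Let addE (g h : CX) x : (cs_add (g : cts_algebra R X) h : CX) x = g x + h x.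
Proof. by []. Qed.

Let mulE (g h : CX) x : (cs_mul (g : cts_algebra R X) h : CX) x = g x * h x.
Proof. by []. Qed.

Let scaleE a (g : CX) x : (cs_scale a (g : cts_algebra R X) : CX) x = a * g x.
Proof. by []. Qed.

Let starE (g : CX) x : (cs_star (g : cts_algebra R X) : CX) x = conjc (g x).
Proof. by []. Qed.

Let oneE x : (cs_one (cts_algebra R X) : CX) x = 1.
Proof. by []. Qed.

Let zeroE x : (cs_zero (cts_algebra R X) : CX) x = 0.
Proof. by []. Qed.

(** If evaluation at [z] agreed with no point of [X], the kernel of the character would contain at
    each point a nonnegative function positive there. By compactness finitely many of them sum to an
    everywhere positive, hence invertible, element of the kernel. *)
Lemma character_point z : exists x, forall g : CX, ev g z = g x.
Proof.
apply: contrapT => /forallNP nx.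
have [_ _ cX _] := contX.
have [G [Gz _ Gpos]] : exists G : CX,
    [/\ ev G z = 0, forall x, 0 <= G x & forall x, [set: X] x -> 0 < G x].
  apply: (compact_ind (P := fun A => exists G : CX,
    [/\ ev G z = 0, forall x, 0 <= G x & forall x, A x -> 0 < G x]) cX).
  - by exists (cs_zero (cts_algebra R X)); split=> [|x|//]; rewrite ?ev0 ?zeroE ?lexx.
  - move=> A B [G [Gz G0 GA]] [H [Hz H0 HB]].
    exists (cs_add (G : cts_algebra R X) H); split.
    + by rewrite evD Gz Hz addr0.
    + by move=> x; rewrite addE addr_ge0.
    + move=> x [Ax|Bx]; rewrite addE; first exact: (ltr_wpDr (H0 x) (GA _ Ax)).
      exact: (ltr_wpDl (G0 x) (HB _ Bx)).
  - by move=> A B AB [G [Gz G0 GB]]; exists G; split=> // x /AB; exact: GB.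
  - move=> x _; have /existsNP[g gx] := nx x.
    (* Subtracting from [g] its value under the character gives a kernel element nonzero at [x]; its
       product with its conjugate is moreover nonnegative. *)
    pose h : CX := cs_add (g : cts_algebra R X) (cs_scale (- ev g z) (cs_one _)).
    have hz : ev h z = 0 by rewrite evD evZ ev1 mulr1 subrr.
    have hx : h x != 0.
      rewrite /h addE scaleE oneE mulr1 subr_eq0.
      by apply/eqP => h0; apply: gx; rewrite h0.
    have hx0 : 0 < normc (h x).
      have : 0 < `|h x| by rewrite normr_gt0.
      by rewrite normCE ltcR.
    exists [set y | 0 < normc (h y)].
      apply: open_nbhs_nbhs; split; last exact: hx0.
      have /continuousP/(_ _ (@open_gt R 0)) : continuous (fun y => normc (h y)); last exact.
        exact: continuous_normc (@cts_fun _ _ h).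
    exists (cs_mul (h : cts_algebra R X) (cs_star (h : cts_algebra R X))); split.
    + by rewrite evM hz mul0r.
    + by move=> y; rewrite mulE starE -sqr_normc exprn_ge0.
    + move=> y hy; rewrite mulE starE -sqr_normc exprn_gt0//.
      by rewrite normCE ltcR.
have Ginv : continuous (fun x => (G x)^-1 : C).
  move=> x; apply: cvgV; last exact: cts_fun.
  by rewrite gt_eqF//; exact: Gpos.
pose K : CX := mkcts Ginv.
have : ev (cs_mul (G : cts_algebra R X) K) z = 1.
  rewrite -(ev1 z); congr ev; apply/continuousEP => x; rewrite mulE oneE /K /=.
  by rewrite divff//gt_eqF//; exact: Gpos.
by rewrite evM Gz mul0r => /eqP; rewrite eq_sym oner_eq0.
Qed.

Lemma complex_bump (x : X) (v : set X) : open v -> v x ->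
  exists g : CX, g x = 1 /\ forall y, ~ v y -> g y = 0.
Proof.
move=> ov vx; have [_ hX cX _] := contX.
have [g gc [_ gx gv]] := bump_function R hX cX ov vx.
have gcc : continuous (fun y => (g y)%:C : C).
  by move=> y; apply: continuous_comp; [exact: gc|exact: real_complex_continuous].
have gE y : (mkcts gcc : CX) y = (g y)%:C by [].
by exists (mkcts gcc : CX); split=> [|y /gv gy]; rewrite gE ?gx ?gy.
Qed.

(** The map sends [z] to the point representing evaluation at [z]. Bump functions give its
    continuity, and its surjectivity follows from injectivity of [j], which would kill a bump
    supported off the image. *)
Lemma embedding_comp : exists f : Z -> X, [/\ continuous f, forall x, exists z, f z = x &
  forall (g : CX) z, (j g : CZ) z = g (f z)].
Proof.
have /choice[f fE] := character_point.
have fc : continuous f.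
  move=> z O; rewrite nbhsE => -[v [ov vz] vO].
  have [g [gz gv]] := complex_bump ov vz.
  have ngz : nbhs z [set w | 0 < normc (ev g w)].
    apply: open_nbhs_nbhs; split; last by rewrite /= fE gz normc1 ltr01.
    have /continuousP/(_ _ (@open_gt R 0)) : continuous (fun y => normc (ev g y)); last exact.
      exact: continuous_normc (@cts_fun _ _ (j g : CZ)).
  apply: filterS ngz => w /=; rewrite fE => gw; apply: vO; apply: contrapT => nv.
  by move: gw; rewrite gv// normc0 ltxx.
exists f; split=> //; last by move=> g z; exact: fE.
move=> x; apply: contrapT => nx.
have [_ hX _ _] := contX; have [_ _ cZ _] := contZ.
have cl : closed (f @` [set: Z]) by apply: compact_closed => //; exact: compact_image.
have [||g [gx gv]] := @complex_bump x (~` (f @` [set: Z])).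
- by rewrite openC.
- by move=> [z _ fz]; apply: nx; exists z.
have g0 : g = cs_zero (cts_algebra R X).
  apply: (emb_inj ej); rewrite (emb_zero ej); apply/continuousEP => z.
  by rewrite -[LHS]/(ev g z) fE gv//; apply; exists z.
by move: gx => /eqP; rewrite g0 zeroE eq_sym oner_eq0.
Qed.

End Gelfand.

Section Embeddings.
Import ComplexField.Normc.
Local Open Scope complex_scope.
Variable R : realType.

Lemma cstar_embedding_comp (A B D : cstar_structure R) (j : A -> B) (k : B -> D) :
  cstar_embedding j -> cstar_embedding k -> cstar_embedding (k \o j).
Proof.
move=> ej ek; split=> /=.
- exact: inj_comp (emb_inj ek) (emb_inj ej).
- by rewrite (emb_zero ej) (emb_zero ek).
- by rewrite (emb_one ej) (emb_one ek).
- by move=> x y; rewrite (emb_add ej) (emb_add ek).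
- by move=> x y; rewrite (emb_mul ej) (emb_mul ek).
- by move=> a x; rewrite (emb_scale ej) (emb_scale ek).
- by move=> x; rewrite (emb_star ej) (emb_star ek).
- by move=> x; rewrite (emb_norm ek) (emb_norm ej).
Qed.

Lemma emb_qf_eval (A B : cstar_structure R) (j : A -> B) (V : Type) (e : V -> A) phi :
  cstar_embedding j -> qf_eval (j \o e) phi = qf_eval e phi.
Proof.
move=> ej; have tE t : term_eval (j \o e) t = j (term_eval e t).
  elim: t => [v|||t1 IH1 t2 IH2|t1 IH1 t2 IH2|a t1 IH1|t1 IH1] /=.
  - by [].
  - by rewrite (emb_zero ej).
  - by rewrite (emb_one ej).
  - by rewrite IH1 IH2 (emb_add ej).
  - by rewrite IH1 IH2 (emb_mul ej).
  - by rewrite IH1 (emb_scale ej).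
  - by rewrite IH1 (emb_star ej).
elim: phi => [t|n f cf phis ih] /=; first by rewrite tE (emb_norm ej).
by congr f; apply/rowP => i; rewrite !mxE ih.
Qed.

Lemma comp_join_tuples (A B : Type) (n m : nat) (j : A -> B) (x : 'I_n -> A) (b : 'I_m -> A) :
  j \o join_tuples x b = join_tuples (j \o x) (j \o b).
Proof. by apply/funext => -[]. Qed.

Local Notation C := (R[i] : numClosedFieldType).

Lemma cs_norm_le (Z : topologicalType) (g : continuousType Z C) (c : R) : continuum Z ->
  cs_norm (g : cts_algebra R Z) <= c <-> forall z, normc (g z) <= c.
Proof.
move=> [[z0 _] _ cZ _]; split=> [gle z|gle]; last first.
  apply: sup_le_ub; first by exists (normc (g z0)), z0.
  by move=> _ [z _ <-]; exact: gle.
apply: le_trans gle; apply: sup_upper_bound; last by exists z.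
split; first by exists (normc (g z0)), z0.
have gc : continuous (fun z => normc (g z)).
  exact: continuous_normc (@cts_fun _ _ g).
have /compact_bounded[M [_ MK]] := compact_image gc cZ.
exists (M + 1) => _ [k _ <-]; apply: le_trans (ler_norm _) _.
by apply: (MK (M + 1)); [rewrite ltrDl|exists k].
Qed.

End Embeddings.

(** * From approximation of extensions to existential closedness *)

Section Existential.
Import ComplexField.Normc.
Local Open Scope complex_scope.
Variables (R : realType) (X : topologicalType).
Local Notation C := (R[i] : numClosedFieldType).
Local Notation Q := {ptws (nat * nat)%type -> C}.

(** The topological counterpart of existential closedness: [W] and [Us] describe a basic Vietoris
    neighbourhood of the image of [Z], to be reached by the graph of a bounded tuple on [X]
    itself. *)
Definition approximates_extensions := forall (Z : topologicalType) (f : Z -> X) (x : Z -> Q),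
  continuum Z -> continuous f -> (forall w, exists z, f z = w) -> continuous x ->
  (forall z t, cdisc t.2 (x z t)) ->
  forall (W : set (X * Q)) (Us : seq (set (X * Q))), open W ->
    (forall U, U \in Us -> open U) -> (forall z, W (f z, x z)) ->
    (forall U, U \in Us -> exists z, U (f z, x z)) ->
  exists x' : X -> Q, [/\ continuous x', forall w t, cdisc t.2 (x' w t),
    forall w, W (w, x' w) & forall U, U \in Us -> exists w, U (w, x' w)].

Hypotheses (contX : continuum X) (approx : approximates_extensions).

(** The value of the formula is Vietoris-continuous in the image of [Z], so a tuple on [X] with a
    close enough graph has a value within any prescribed [d]. *)
Lemma inf_formula_approx (Z : topologicalType) (f : Z -> X) (n m : nat) (r : 'I_n -> nat)
    (phi : qf_formula R ('I_n + 'I_m)) (b : 'I_m -> cts_algebra R X)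
    (x : 'I_n -> cts_algebra R Z) (c : 'I_m -> cts_algebra R Z) :
  continuum Z -> continuous f -> (forall w, exists z, f z = w) ->
  (forall i z, (c i : continuousType Z C) z = (b i : continuousType X C) (f z)) ->
  (forall i, cs_norm (x i) <= (r i)%:R) ->
  (inf_formula r phi b <= (qf_eval (join_tuples x c) phi)%:E)%E.
Proof.
move=> contZ fc fsurj cb xr.
pose S : topologicalType := (X * Q)%type.
(* Parameters are read off the point of [X], and variable [l] off the coordinate of [Q] whose bound
   is its own radius [r l]. *)
pose e (v : 'I_n + 'I_m) (s : S) : C :=
  match v with inl l => s.2 (val l, r l) | inr i => (b i : continuousType X C) s.1 end.
have ec v : continuous (e v).
  case: v => [l|i] s.
    apply: (@continuous_comp _ _ _ snd (fun q : Q => q (val l, r l))); first exact: cvg_snd.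
    exact: ptws_eval_continuous.
  apply: (@continuous_comp _ _ _ fst (b i : continuousType X C)); first exact: cvg_fst.
  exact: cts_fun.
(* Only the coordinates [(l, r l)] matter to the formula; all others are set to 0, which lies in
   every disc. *)
pose xq (z : Z) : Q := fun t => if insub t.1 is Some l then
  if r l == t.2 then (x l : continuousType Z C) z else 0 else 0.
have xqE z l : xq z (val l, r l) = (x l : continuousType Z C) z.
  by rewrite /xq /= valK eqxx.
have xqc : continuous xq.
  apply: continuous_ptws => t z; rewrite /xq.
  case: insub => [l|]; last exact: cvg_cst.
  by case: eqP => _; [exact: cts_fun|exact: cvg_cst].
have xqd z t : cdisc t.2 (xq z t).
  rewrite /xq; case: insub => [l|]; last exact: cdisc0.
  by case: eqP => [<-|_]; [exact: (cs_norm_le _ _ contZ).1|exact: cdisc0].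
pose k z : S := (f z, xq z).
have kc : continuous k by exact: continuous_pair.
have EZ : qf_eval (join_tuples x c) phi = qf_val e phi (range k).
  by apply: qf_eval_val => -[l|i] z; [exact: esym (xqE z l)|exact: cb].
have [Z0 _ cZ _] := contZ.
have ck : compact (range k) by exact: compact_image.
have k0 : range k !=set0 by have [z _] := Z0; exists (k z), z.
apply/lee_addgt0Pr => d d0.
have /cvgrPdist_lt/(_ d d0)[W [Us [oW oU KW KU near]]] := @qf_val_cvg R S _ e ec phi _ ck k0.
have [||x' [x'c x'd x'W x'U]] := approx contZ fc fsurj xqc xqd oW oU.
- by move=> z; apply: KW; exists z.
- by move=> U /KU[_ [[z _ <-] Uz]]; exists z.
have xc l : continuous (fun w => x' w (val l, r l)).
  move=> w; apply: (@continuous_comp _ _ _ x' (fun q : Q => q (val l, r l))); first exact: x'c.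
  exact: ptws_eval_continuous.
pose y (l : 'I_n) : cts_algebra R X := mkcts (xc l) : continuousType X C.
have EX : qf_eval (join_tuples y b) phi = qf_val e phi (range (fun w => (w, x' w) : S)).
  by apply: qf_eval_val => -[l|i] z.
apply: (@le_trans _ _ (qf_eval (join_tuples y b) phi)%:E).
  apply: ereal_inf_lbound; exists y => //= l; apply/(cs_norm_le _ _ contX) => w.
  exact: x'd.
have : `|qf_eval (join_tuples x c) phi - qf_eval (join_tuples y b) phi| < d.
  rewrite EX EZ; apply: near; first by move=> _ [w _ <-]; exact: x'W.
  by move=> U /x'U[w Uw]; exists (w, x' w); split=> //; exists w.
by rewrite ltr_distlC -EFinD lee_fin => /andP[_ /ltW].
Qed.

(** Approximation shows that no value in the extension undercuts the infimum over [X]; the converse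
    inequality holds because tuples of the smaller model map to tuples of the larger one with the
    same values. *)
Theorem approximates_co_existentially_closed : co_existentially_closed R X.
Proof.
split=> //; split.
  by exists X; split=> //; exists id; split; [split|by exists id].
move=> N j [Z [contZ [k [ek _]]]] ej n m r phi b.
have [f [fc fsurj fE]] := embedding_comp contX contZ (cstar_embedding_comp ej ek).
apply/eqP; rewrite eq_le; apply/andP; split; apply: le_ereal_inf_tmp => _ [x xr <-].
  rewrite -(emb_qf_eval _ _ ek) comp_join_tuples.
  apply: (inf_formula_approx _ contZ fc fsurj) => [i z|i].
    exact: fE.
  by have := xr i; rewrite -(emb_norm ek).
apply: ereal_inf_lbound; exists (j \o x).
  by move=> i; have := xr i; rewrite -(emb_norm ej).
by rewrite -comp_join_tuples (emb_qf_eval _ _ ej).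
Qed.

End Existential.

(** * Weight *)

Section Weight.

Lemma open_basis (X : topologicalType) : basis [set U : set X | open U].
Proof.
split=> // x W; rewrite nbhsE => -[U [oU Ux] UW].
by exists U.
Qed.

Lemma minimal_basis_ex (X : topologicalType) : exists B : set (set X), minimal_basis B.
Proof.
have [|B bB Bmin] := @card_min _ [set B : set (set X) | basis B].
  by exists [set U | open U]; exact: open_basis.
by exists B; split=> // B' /Bmin.
Qed.

(** A finite base gives [x] a least neighbourhood, which in a Hausdorff space is the singleton; a
    clopen singleton is the whole of a connected space. *)
Lemma infinite_basis (X : topologicalType) (B : set (set X)) : continuum X ->
  (exists x x' : X, x <> x') -> basis B -> infinite_set B.
Proof.
move=> [_ hX _ conX] [x [x' xx']] [Bo Bx] finB.
have [s sE] : exists s : seq (set X), B `&` [set U | U x] = [set` s].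
  by apply/finite_seqP; exact: finite_setIl.
have nx : nbhs x [set y | forall U, U \in s -> U y].
  have : forall U, U \in s -> open_nbhs x U.
    move=> U Us; have [BU Ux] : (B `&` [set U | U x]) U by rewrite sE.
    by split=> //; exact: Bo.
  elim: s {sE} => [|U s ih] sx; first exact: filterS filterT.
  have h1 : nbhs x U by apply/open_nbhs_nbhs/sx; rewrite inE eqxx.
  have h2 : nbhs x [set y | forall U, U \in s -> U y].
    by apply: ih => U' U's; apply: sx; rewrite inE U's orbT.
  by apply: filterS (filterI h1 h2) => y [Uy sy] U'; rewrite inE => /orP[/eqP ->|/sy].
have x1 : nbhs x [set x].
  apply: filterS nx => y sy; apply: contrapT => nyx.
  have xU : nbhs x (~` [set y]).
    apply: open_nbhs_nbhs; split; last by move=> xy; apply: nyx; rewrite xy.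
    by rewrite openC; apply: accessible_closed_set1; exact: hausdorff_accessible.
  have [U [BU Ux] Uy] := Bx x _ xU.
  have : U \in s by have : (B `&` [set U | U x]) U by []; rewrite sE.
  by move=> /sy /Uy; apply.
have : [set x] = [set: X].
  apply: conX; first by exists x.
    exists [set x]; last by rewrite setTI.
    by rewrite openE => _ ->.
  exists [set x]; last by rewrite setTI.
  by apply: accessible_closed_set1; exact: hausdorff_accessible.
by move=> /seteqP[_ /(_ x' Logic.I) /= h]; apply: xx'; rewrite h.
Qed.

(** A fibre is compact, so it is covered by finitely many members of [A] inside a given open set,
    and [f] is closed. Since [A] is infinite, its finite sequences are no more numerous than its
    members. *)
Lemma quotient_basis (X Y : topologicalType) (f : X -> Y) (A : set (set X)) :
  continuous f -> (forall y, exists x, f x = y) -> compact [set: X] -> hausdorff_space Y ->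
  basis A -> infinite_set A -> exists2 B : set (set Y), basis B & B #<= A.
Proof.
move=> fc fsurj cX hY [Ao Ax] infA.
pose un (s : seq (set_type A)) : set X := [set x | exists2 a, a \in s & (set_val a) x].
have un_cat s s' x : un (s ++ s') x <-> un s x \/ un s' x.
  split=> [[a]|[[a as_ ax]|[a as_ ax]]]; last 2 first.
  - by exists a; rewrite ?mem_cat ?as_.
  - by exists a; rewrite ?mem_cat ?as_ ?orbT.
  by rewrite mem_cat => /orP[as_|as_] ax; [left|right]; exists a.
have oun s : open (un s).
  rewrite (_ : un s = \bigcup_(a in [set` s]) set_val a).
    by apply: bigcup_open => a _; apply: Ao; exact: set_valP.
  by apply/seteqP; split=> x [a as_ ax]; exists a.
(* The largest subset of [Y] whose preimage lies in [un s]; it is open because [f] is closed. *)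
pose im s : set Y := ~` (f @` (~` un s)).
exists (range im).
  split=> [_ [s _ <-]|y W].
    rewrite openC; apply: compact_closed => //; apply: compact_image => //.
    by apply: (subclosed_compact _ cX) => //; rewrite closedC.
  rewrite nbhsE => -[G [oO Oy] OW].
  have cfy : compact (f @^-1` [set y]).
    apply: (subclosed_compact _ cX) => //; apply: (continuous_closedP _).1 => //.
    by apply: accessible_closed_set1; exact: hausdorff_accessible.
  have [s sO ys] : exists2 s, un s `<=` f @^-1` G & f @^-1` [set y] `<=` un s.
    apply: (compact_ind (P := fun K => exists2 s, un s `<=` f @^-1` G & K `<=` un s) cfy).
    - by exists [::] => // x [].
    - move=> K K' [s sO Ks] [s' sO' Ks']; exists (s ++ s').
        by move=> x /un_cat[/sO|/sO'].
      by move=> x [/Ks|/Ks'] sx; apply/un_cat; [left|right].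
    - by move=> K K' KK [s sO Ks]; exists s => //; exact: subset_trans Ks.
    - move=> x /= fxy; have xO : nbhs x (f @^-1` G).
        by apply: fc; rewrite fxy; exact: open_nbhs_nbhs.
      have [a [Aa ax] aO] := Ax x _ xO.
      exists a; first by apply: open_nbhs_nbhs; split=> //; exact: Ao.
      exists [:: SigSub (mem_set Aa)]; last first.
        by move=> x' ax'; exists (SigSub (mem_set Aa)); rewrite ?inE.
      by move=> x' [b]; rewrite inE => /eqP -> /aO.
  exists (im s); first split; [by exists s|by move=> [x nx fx]; apply: nx; exact: ys|].
  move=> y' nfy'; have [x fx] := fsurj y'; apply: OW; rewrite -fx.
  by apply: sO; apply: contrapT => nx; apply: nfy'; exists x.
apply: (card_le_trans (card_image_le _ _)).
have [g gI] := embeds_seq (infinite_set_type infA) (ex_intro _ id (fun x y => id) : embeds _ _).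
apply: (@card_leI _ _ _ _ (fun s => set_val (g s))) => [s _|s s' _ _ /val_inj/gI//].
exact: set_valP.
Qed.

End Weight.

(** * A co-existentially closed continuum over [Y] with the weight of [Y] *)

Section Existence.
Variables (R : realType) (Y : topologicalType).
Hypotheses (contY : continuum Y) (nondegY : exists y y' : Y, y <> y').
Local Notation C := (R[i]%C : numClosedFieldType).

Lemma co_existentially_closed_cover : exists X : topologicalType,
  [/\ co_existentially_closed R X, same_weight X Y &
      exists2 f : X -> Y, continuous f & forall y, exists x, f x = y].
Proof.
have [B [bB Bmin]] := minimal_basis_ex Y; have [Bo Bx] := bB.
have infB := infinite_basis contY nondegY bB.
pose I : choiceType := set_type B.
have infI : infinite_set [set: I] by exact: infinite_set_type.
pose bx := box ((rat * rat) * (rat * rat))%type I.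
have embI : embeds I I by exists id.
have emb_box : embeds bx I.
  apply: embeds_prod => //; last by apply: embeds_seq => //; exact: embeds_count.
  apply: embeds_prod => //; apply: embeds_seq => //.
  apply: embeds_prod => //; last exact: embeds_count.
  by apply: embeds_prod => //; exact: embeds_count.
have [g gI] := embeds_seq infI emb_box.
(* [dec] is a left inverse of the injection [g] of lists of boxes into [I]. Indices off the range of
   [g] get the empty list, a requirement that no nonempty continuum satisfies. *)
have /choice[dec decP] : forall i, exists s, forall s', g s' = i -> s = s'.
  move=> i; have [[s gs]|ns] := pselect (exists s, g s = i).
    by exists s => s' gs'; apply: gI; rewrite gs.
  by exists [::] => s' gs'; case: ns; exists s'.
have dec_surj s : exists i, dec i = s by exists (g s); exact: decP.
have yb_open (k : I) : open (set_val k) by apply: Bo; exact: set_valP.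
have yb_basis y A : nbhs y A -> exists2 k : I, (set_val k) y & set_val k `<=` A.
  by move=> /Bx[U [BU Uy] UA]; exists (SigSub (mem_set BU)).
have [[J L] gJL mJL] := @maximal_good R Y C contY (@hausdorff_C R) 0 (@cdisc R) (@csc R)
  (@cdisc0 R) (@cdisc_compact R) (@csc_continuous R) (@csc1 R) (@csc0 R) (@csc_disc R)
  _ (@cbox R) I set_val dec.
have contX := limit_continuum contY (@hausdorff_C R) gJL.
have piC := @limit_proj Y C I L.
have piS := limit_proj_surj gJL.
pose X : topologicalType := set_type L.
pose f (p : X) : Y := (set_val p).1.
have nondegX : exists x x' : X, x <> x'.
  have [y [y' yy']] := nondegY; have [[p py] [p' py']] := (piS y, piS y').
  by exists p, p' => pp'; apply: yy'; rewrite -py -py' pp'.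
exists X; split; last by exists f.
- apply: approximates_co_existentially_closed => // Z h x contZ hc hsurj xc xd W Us oW oU Wx Ux.
  exact: (limit_approx (@cbox_open R) (@cbox_basis R) yb_open yb_basis dec_surj gJL mJL
     contZ hc hsurj xc xd oW oU Wx Ux).
- have bX := limit_basis (@cbox_open R) (@cbox_basis R) yb_open yb_basis gJL.
  set A := (X in basis X) in bX.
  have AB : A #<= B.
    apply: (card_le_trans (card_image_le _ _)); have [e eI] := emb_box.
    apply: (@card_leI _ _ _ _ (fun b => set_val (e b))) => [b _|b b' _ _ /val_inj/eI//].
    exact: set_valP.
  (* The weight of [X] is no smaller than that of [Y]: a base of [X] yields one of [Y] of at most
     the same size, to be compared with the minimal base [B]. *)
  have Ble (A' : set (set X)) : basis A' -> B #<= A'.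
    move=> bA'; have [_ _ cX _] := contX; have [_ hY _ _] := contY.
    have infA' := infinite_basis contX nondegX bA'.
    have [B' bB' B'A'] := quotient_basis piC piS cX hY bA' infA'.
    exact: card_le_trans (Bmin _ bB') B'A'.
  exists A, B; split=> //; last by rewrite card_eq_le AB Ble.
  by split=> // A' /Ble; exact: card_le_trans.
Qed.

End Existence.

Theorem theorem4p14 (R : realType) (Y : topologicalType)
    (contY : continuum Y)
    (nondegY : exists y y' : Y, y <> y')
    (hiY : hereditarily_indecomposable Y) :
  exists X : topologicalType,
    [/\ co_existentially_closed R X,
        same_weight X Y
      & rank_le (cechH1 Y) (cechH1 X)].
Proof.
have [X [ecX wX [f fc fsurj]]] := co_existentially_closed_cover R contY nondegY.
exists X; split=> //.
by have [contX _] := ecX; exact: rank_le_H1 R X Y f fc fsurj contX contY hiY.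
Qed.
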